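(* Let $p\ge1$ be an integer, $L_p>0$, $D_{\mathcal Z}>0$ and $T\in\mathbb N_+$. Let $$\bar{\mathcal X}=\{\boldsymbol x\in\mathbb R^{T+1}:0\le x_{[T+1]}\le x_{[T]}\le\cdots\le x_{[1]}\le1\},\qquad \bar{\mathcal Y}=\{\boldsymbol y\in\mathbb R^{T+1}:0\le y_{[i]}\le1,\ i=1,\dots,T+1\},$$ $$\bar f(\boldsymbol x,\boldsymbol y)=\frac{L_p}{2^{p+1}p!}\Bigl(y_{[1]}(1-x_{[1]})^p+\sum_{i=1}^{T}y_{[i+1]}(x_{[i]}-x_{[i+1]})^p\Bigr),$$ $\bar{\mathcal Z}=\bar{\mathcal X}\times\bar{\mathcal Y}$, whose diameter is $D_{\bar{\mathcal Z}}=\sqrt{2(T+1)}$. Put $\beta=D_{\bar{\mathcal Z}}/D_{\mathcal Z}$, $f(\boldsymbol x,\boldsymbol y)=\bar f(\beta\boldsymbol x,\beta\boldsymbol y)/\beta^{p+1}$, $\mathcal X=\bar{\mathcal X}/\beta$, $\mathcal Y=\bar{\mathcal Y}/\beta$, $\mathcal Z=\mathcal X\times\mathcal Y$ (which has diameter $D_{\mathcal Z}$), and $\boldsymbol F=(\nabla_xf,-\nabla_yf)$. Then: 1. $f$ is convex in $\boldsymbol x$ and concave in $\boldsymbol y$ on $\mathcal X\times\mathcal Y$ and has $L_p$-Lipschitz continuous $p$th-order derivatives on $\mathcal X\times\mathcal Y$. 2. There is a constant $c_p>0$ depending only on $p$ (not on $T,L_p,D_{\mathcal Z}$) such that for every sequence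 $\{\boldsymbol z_t\}_{t=0}^{T}$ generated on $f$ (over $\mathcal X\times\mathcal Y$) by a $p$th-order tensor algorithm (as defined in the context), $$r^{\rm tan}_{\boldsymbol F}(\boldsymbol z_T)\ \ge\ c_p\,\frac{L_pD_{\mathcal Z}^p}{(T+1)^{(3p-1)/2}}.$$ In other words, the number of $p$th-order oracle calls needed by this algorithm class to find an $\epsilon$-solution (a point $\boldsymbol z$ with $r^{\rm tan}_{\boldsymbol F}(\boldsymbol z)\le\epsilon$), in the worst case over such problems, is $\Omega\bigl((D_{\mathcal Z}^pL_p/\epsilon)^{2/(3p-1)}\bigr)$.
   Context: $x_{[i]}$ denotes the $i$th coordinate; $S/\beta=\{\boldsymbol z:\beta\boldsymbol z\in S\}$. $\|\cdot\|$ is the Euclidean norm, and for tensors the spectral norm $\|T\|=\sup\{\langle T,v_1\otimes\cdots\otimes v_k\rangle:\|v_i\|\le1\}$; ''$L_p$-Lipschitz continuous $p$th-order derivatives'' means $\|\nabla^pf(\boldsymbol z)-\nabla^pf(\boldsymbol z')\|\le L_p\|\boldsymbol z-\boldsymbol z'\|$. Tangent residual: $r^{\rm tan}_{\boldsymbol F}(\boldsymbol z)=\min_{\boldsymbol c\in\mathcal N_{\mathcal Z}(\boldsymbol z)}\|\boldsymbol F(\boldsymbol z)+\boldsymbol c\|$, where $\mathcal N_{\mathcal Z}(\boldsymbol z)=\{\boldsymbol v:\langle\boldsymbol v,\boldsymbol z'-\boldsymbol z\rangle\le0\ \forall\boldsymbol z'\in\mathcal Z\}$. $q$th-order tensor step: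 for a convex compact set $\mathcal W\subset\mathbb R^d$, a smooth operator $\boldsymbol G$ on $\mathbb R^d$, a point $\bar{\boldsymbol w}$ and $M>0$, $\mathcal T_q(\bar{\boldsymbol w};\boldsymbol G,M)$ denotes a point $\boldsymbol w\in\mathcal W$ such that $$\Bigl\langle \sum_{k=0}^{q-1}\tfrac1{k!}\nabla^k\boldsymbol G(\bar{\boldsymbol w})[\boldsymbol w-\bar{\boldsymbol w}]^k+\tfrac{M}{q!}\|\boldsymbol w-\bar{\boldsymbol w}\|^{q-1}(\boldsymbol w-\bar{\boldsymbol w}),\ \boldsymbol w'-\boldsymbol w\Bigr\rangle\ge0\quad\forall\boldsymbol w'\in\mathcal W.$$ $p$th-order tensor algorithm: it starts at $\boldsymbol z_0=(\boldsymbol x_0,\boldsymbol y_0)=(\boldsymbol 0,\boldsymbol 0)$, and at each iteration $t$ it picks $\bar{\boldsymbol x}_t\in{\rm Span}(\boldsymbol x_0,\dots,\boldsymbol x_t)$, $\bar{\boldsymbol y}_t\in{\rm Span}(\boldsymbol y_0,\dots,\boldsymbol y_t)$, an order $q\in\{1,\dots,p\}$ and a regularization parameter $M_t>0$, and does one of the following (each iteration counts as one oracle call): (A) $\boldsymbol x_{t+1}=\mathcal T_q(\bar{\boldsymbol x}_t;\nabla_xf(\cdot,\bar{\boldsymbol y}_t),M_t)$ over $\mathcal W=\mathcal X$, and $\boldsymbol y_{t+1}=\boldsymbol y_t$; (B) $\boldsymbol y_{t+1}=\mathcal T_q(\bar{\boldsymbol y}_t;-\nabla_yf(\bar{\boldsymbol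 x}_t,\cdot),M_t)$ over $\mathcal W=\mathcal Y$, and $\boldsymbol x_{t+1}=\boldsymbol x_t$; (C) $(\boldsymbol x_{t+1},\boldsymbol y_{t+1})=\mathcal T_q((\bar{\boldsymbol x}_t,\bar{\boldsymbol y}_t);\boldsymbol F,M_t)$ over $\mathcal W=\mathcal Z$. The iterates are $\boldsymbol z_t=(\boldsymbol x_t,\boldsymbol y_t)$. *)

(* Defs.v *)
From HB Require Import structures.
From mathcomp Require Import all_boot all_order all_algebra.
From mathcomp Require Import all_classical all_reals all_analysis.

Set Implicit Arguments.
Unset Strict Implicit.
Unset Printing Implicit Defensive.

Import Order.TTheory GRing.Theory Num.Theory.
Import numFieldNormedType.Exports.

Local Open Scope classical_set_scope.
Local Open Scope ring_scope.

(* The library norm on 'rV[R]_d is the sup norm; it is used only for the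
   topology (equivalently, for differentiation).  All metric quantities use the
   Euclidean norm below. *)
Section Euclidean.
Variable R : realType.

Definition dot d (u v : 'rV[R]_d) : R := \sum_(i < d) u 0 i * v 0 i.

Definition enorm d (u : 'rV[R]_d) : R := Num.sqrt (dot u u).

Definition diameter d (S : set 'rV[R]_d) : R :=
  sup [set r | exists z z', [/\ S z, S z' & r = enorm (z - z')]].

Definition dilate_inv d (S : set 'rV[R]_d) (b : R) : set 'rV[R]_d :=
  [set z | S (b *: z)].

Definition prod_set m n (X : set 'rV[R]_m) (Y : set 'rV[R]_n) :
    set 'rV[R]_(m + n) :=
  [set z | X (lsubmx z) /\ Y (rsubmx z)].

Definition normal_cone d (S : set 'rV[R]_d) (z : 'rV[R]_d) : set 'rV[R]_d :=
  [set v | forall z', S z' -> dot v (z' - z) <= 0].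

(* The infimum is a minimum, as the normal cone is closed and contains 0. *)
Definition tangent_residual d (F : 'rV[R]_d -> 'rV[R]_d) (S : set 'rV[R]_d)
    (z : 'rV[R]_d) : R :=
  inf [set enorm (F z + c) | c in normal_cone S z].

End Euclidean.

Section Derivatives.
Variable R : realType.

(* iter_derive g [:: v1; ...; vk] z is the value of the k-th derivative tensor
   of g at z on (v1, ..., vk), obtained by iterating directional derivatives. *)
Fixpoint iter_derive (V W : normedModType R) (g : V -> W) (vs : seq V) :
    V -> W :=
  if vs is v :: vs' then fun z => 'D_v (iter_derive g vs') z else g.

Definition gradient d (g : 'rV[R]_d -> R) (z : 'rV[R]_d) : 'rV[R]_d :=
  \row_(i < d) 'D_(delta_mx 0 i) g z.

(* Extended-real supremum, so that an unbounded form gets norm +oo. *)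
Definition spectral_norm d k (A : k.-tuple 'rV[R]_d -> R) : \bar R :=
  ereal_sup [set (A v)%:E |
    v in [set v : k.-tuple 'rV[R]_d | forall i, enorm (tnth v i) <= 1]].

(* The derivative operator 'D is total, so p-fold differentiability (near each
   point of S) has to be required explicitly. *)
Definition lipschitz_derivatives d (p : nat) (L : R) (S : set 'rV[R]_d)
    (g : 'rV[R]_d -> R) : Prop :=
  (forall (vs : seq 'rV[R]_d) z, (size vs < p)%N -> S z ->
     \forall w \near z, differentiable (iter_derive g vs) w) /\
  (forall z z', S z -> S z' ->
     (spectral_norm (fun vs : p.-tuple 'rV[R]_d =>
        (iter_derive g vs z - iter_derive g vs z')%R)
      <= (L * enorm (z - z'))%:E)%E).

End Derivatives.

Section TensorAlgorithm.
Variable R : realType.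

(* w is an admissible value of the q-th order tensor step T_q(wb; G, M)
   over W. *)
Definition tensor_step d (W : set 'rV[R]_d) (q : nat) (wb : 'rV[R]_d)
    (G : 'rV[R]_d -> 'rV[R]_d) (M : R) (w : 'rV[R]_d) : Prop :=
  W w /\
  forall w', W w' ->
    0 <= dot (\sum_(k < q) (k`!%:R)^-1 *: iter_derive G (nseq k (w - wb)) wb
              + (M / q`!%:R * enorm (w - wb) ^+ q.-1) *: (w - wb))
             (w' - w).

Definition uncurry_mx m n (f : 'rV[R]_m -> 'rV[R]_n -> R) :
    'rV[R]_(m + n) -> R :=
  fun z => f (lsubmx z) (rsubmx z).

Definition grad_x m n (f : 'rV[R]_m -> 'rV[R]_n -> R) x y : 'rV[R]_m :=
  gradient (fun x' => f x' y) x.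

Definition grad_y m n (f : 'rV[R]_m -> 'rV[R]_n -> R) x y : 'rV[R]_n :=
  gradient (fun y' => f x y') y.

Definition saddle_op m n (f : 'rV[R]_m -> 'rV[R]_n -> R) :
    'rV[R]_(m + n) -> 'rV[R]_(m + n) :=
  fun z => row_mx (grad_x f (lsubmx z) (rsubmx z))
                  (- grad_y f (lsubmx z) (rsubmx z)).

(* (x t, y t) for t <= N are the iterates of an N-iteration run, on f over
   X * Y, of some p-th order tensor algorithm; the values at t > N are
   irrelevant. *)
Definition tensor_algorithm_run m n (p : nat) (X : set 'rV[R]_m)
    (Y : set 'rV[R]_n) (f : 'rV[R]_m -> 'rV[R]_n -> R) (N : nat)
    (x : nat -> 'rV[R]_m) (y : nat -> 'rV[R]_n) : Prop :=
  [/\ x 0%N = 0, y 0%N = 0 &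
    forall t, (t < N)%N ->
    exists (xb : 'rV[R]_m) (yb : 'rV[R]_n) (q : nat) (M : R),
      [/\ xb \in <<mkseq x t.+1>>%VS, yb \in <<mkseq y t.+1>>%VS,
          (1 <= q <= p)%N, 0 < M &
        [\/ tensor_step X q xb (fun x' => grad_x f x' yb) M (x t.+1) /\
              y t.+1 = y t,
            tensor_step Y q yb (fun y' => - grad_y f xb y') M (y t.+1) /\
              x t.+1 = x t |
            tensor_step (prod_set X Y) q (row_mx xb yb) (saddle_op f) M
              (row_mx (x t.+1) (y t.+1))]]].

End TensorAlgorithm.

(* Coordinates are numbered from 0: the 1-based x_[i] is x 0 (i - 1).  For
   i : 'I_T, the ordinals widen_ord (leqnSn T) i and lift ord0 i of 'I_T.+1
   have values i and i + 1. *)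
Unset Implicit Arguments.
Section HardInstance.
Variable R : realType.

Definition Xbar (T : nat) : set 'rV[R]_T.+1 :=
  [set x | [/\ 0 <= x 0 ord_max,
    forall i : 'I_T, x 0 (lift ord0 i) <= x 0 (widen_ord (leqnSn T) i) &
    x 0 ord0 <= 1]].

Definition Ybar (T : nat) : set 'rV[R]_T.+1 :=
  [set y | forall i, 0 <= y 0 i <= 1].

Definition Zbar (T : nat) : set 'rV[R]_(T.+1 + T.+1) :=
  prod_set (Xbar T) (Ybar T).

Definition fbar (p : nat) (L : R) (T : nat) (x y : 'rV[R]_T.+1) : R :=
  L / (2 ^+ p.+1 * p`!%:R) *
  (y 0 ord0 * (1 - x 0 ord0) ^+ p +
   \sum_(i < T) y 0 (lift ord0 i) *
     (x 0 (widen_ord (leqnSn T) i) - x 0 (lift ord0 i)) ^+ p).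

Definition diam_bar (T : nat) : R := Num.sqrt (2 * T.+1%:R).

Definition beta (D : R) (T : nat) : R := diam_bar T / D.

Definition hard_f (p : nat) (L D : R) (T : nat) (x y : 'rV[R]_T.+1) : R :=
  fbar p L T (beta D T *: x) (beta D T *: y) / beta D T ^+ p.+1.

Definition hard_X (D : R) (T : nat) : set 'rV[R]_T.+1 :=
  dilate_inv (Xbar T) (beta D T).

Definition hard_Y (D : R) (T : nat) : set 'rV[R]_T.+1 :=
  dilate_inv (Ybar T) (beta D T).

Definition hard_Z (D : R) (T : nat) : set 'rV[R]_(T.+1 + T.+1) :=
  prod_set (hard_X D T) (hard_Y D T).

Definition hard_F (p : nat) (L D : R) (T : nat) :
    'rV[R]_(T.+1 + T.+1) -> 'rV[R]_(T.+1 + T.+1) :=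
  saddle_op (hard_f p L D T).

End HardInstance.

Arguments Xbar {R} T _.
Arguments Ybar {R} T _.
Arguments Zbar {R} T _.
Arguments fbar {R} p L T x y.
Arguments beta {R} D T.
Arguments hard_f {R} p L D T x y.
Arguments hard_X {R} D T _.
Arguments hard_Y {R} D T _.
Arguments hard_Z {R} D T _.
Arguments hard_F {R} p L D T _.

(* Main.v *)
Require Import Defs.
From mathcomp Require Import all_boot all_order all_algebra.
From mathcomp Require Import all_classical all_reals all_analysis.
From mathcomp Require Import ring lra zify.

Import Order.TTheory GRing.Theory Num.Theory.
Import numFieldNormedType.Exports.

Set Implicit Arguments.
Unset Strict Implicit.
Unset Printing Implicit Defensive.

Local Open Scope classical_set_scope.
Local Open Scope ring_scope.

(* Put u_1 = 1 - b x_1 and u_(i+1) = b (x_i - x_(i+1)), so that f is a multiple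
   of sum_i y_i u_i ^ p.

   Lower bound.  The coordinate i of F only involves the products
   y_j u_j ^ (p - 1) with j = i, i + 1, and the powers u_i ^ p.  If the base
   point of a tensor step is supported on the first t coordinates, then y_j and
   u_j vanish there for j > t + 1, so these expressions vanish to order p at
   the base point and the Taylor polynomials of degree < p see nothing beyond
   coordinate t + 1.  Comparing the new iterate with its truncation in the
   variational inequality then shows that it is supported on the first t + 1
   coordinates.  After T steps x_(T+1) = 0, so the nonnegative numbers u_i sum
   to 1 and sum_i u_i ^ p >= (T + 1) ^ (1 - p).  Pairing F(z) + c, with c normal,
   against z - z', where z' is the vertex of Z with all coordinates 1 / b,
   bounds the residual below by that sum, up to constants.

   Smoothness.  The p-th derivative changes between two points by the
   (p + 1)-linear form sum_j sum_k eta_(k, j) prod_(l <> k) w_(l, j), where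
   eta_k and w_k are the y-parts and the differences of consecutive entries of
   the x-parts of the directions.  If xi is an x-part and w its differences,
   then |w_j| <= sqrt 2 |xi| and |w| <= 2 |xi|; Cauchy-Schwarz on two factors
   and sum_k |eta_k| prod_(l <> k) |xi_l| <= prod_k (|xi_k| + |eta_k|) give the
   bound 2 ^ (p + 1). *)

(** * Derivatives along lines, Euclidean geometry, tensor steps *)

Section PolynomialsAlongLines.
Variable R : realType.

(** The difference quotient of [g] at [z] along [v] coincides with that of [P] at 0, so directional
    derivatives reduce to derivatives of polynomials. *)
Lemma is_derive_line (V : normedModType R) (g : V -> R) (z v : V)
    (P : {poly R}) :
  (forall s, g (s *: v + z) = P.[s]) -> is_derive z v g P^`().[0].
Proof.
move=> gP.
have gz : g z = P.[0] by rewrite -(gP 0) scale0r add0r.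
have quotE : (fun s : R => s^-1 *: ((g \o shift z) (s *: v) - g z)) =
    (fun s : R => s^-1 *: ((horner P \o shift (0 : R)) (s *: (1 : R)) - P.[0])).
  apply/funext => s /=; congr (_ *: (_ - _)) => //.
  by rewrite gP /= addr0 [s *: 1]mulr1.
have [dP DP] := is_derive_poly P 0.
by apply: DeriveDef; rewrite /derivable /derive quotE //.
Qed.

(** Stated along the whole line, so that the induction can differentiate once more; composing with
    ['X + s%:P] moves the base point to parameter 0. *)
Lemma iter_derive_line n (V : normedModType R) (h : V) k (g : V -> 'rV[R]_n)
    (P : V -> 'I_n -> {poly R}) :
  (forall z i s, g (s *: h + z) 0 i = (P z i).[s]) ->
  forall z i s,
    iter_derive g (nseq k h) (s *: h + z) 0 i = (P z i)^`(k).[s].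
Proof.
move=> gP; elim: k => [|k IH] z i s /=; first by rewrite gP.
set G := iter_derive g (nseq k h) in IH *.
have dG j : is_derive (s *: h + z) h (fun w => G w 0 j) (P z j)^`(k.+1).[s].
  have /(is_derive_line (g := fun w => G w 0 j)) : forall t,
      G (t *: h + (s *: h + z)) 0 j = ((P z j)^`(k) \Po ('X + s%:P)).[t].
    by move=> t; rewrite addrA -scalerDl IH horner_comp !hornerE.
  by rewrite deriv_comp !(hornerE, horner_comp) derivD derivX derivC addr0
    hornerC mulr1 -derivnS.
rewrite derive_mx; last first.
  by apply/derivable_mxP => a j; rewrite [a]ord1; have [] := dG j.
by rewrite mxE; have [_ ->] := dG i.
Qed.

(** The [k]-th derivative at 0 is a multiple of the coefficient of degree [k], which vanishes in a
    multiple of ['X^p]. This is how a Taylor polynomial of degree less than [p] is shown to see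
    nothing. *)
Lemma iter_derive_line_eq0 n (V : normedModType R) (h z : V) k (i : 'I_n)
    (g : V -> 'rV[R]_n) (P : V -> 'I_n -> {poly R}) (Q : {poly R}) p :
  (forall z i s, g (s *: h + z) 0 i = (P z i).[s]) ->
  P z i = Q * 'X^p -> (k < p)%N -> iter_derive g (nseq k h) z 0 i = 0.
Proof.
move=> gP PQ kp; have := iter_derive_line k gP z i 0.
rewrite scale0r add0r => ->.
by rewrite PQ horner_coef0 coef_derivn addn0 coefMXn kp mul0rn.
Qed.

End PolynomialsAlongLines.

Section EuclideanSpace.
Variable R : realType.
Implicit Types d : nat.

Lemma dotC d (u v : 'rV[R]_d) : dot u v = dot v u.
Proof. by apply: eq_bigr => i _; rewrite mulrC. Qed.

Lemma dot_ge0 d (u : 'rV[R]_d) : 0 <= dot u u.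
Proof. by apply: sumr_ge0 => i _; rewrite -expr2 sqr_ge0. Qed.

Lemma enorm_ge0 d (u : 'rV[R]_d) : 0 <= enorm u.
Proof. exact: sqrtr_ge0. Qed.

Lemma sqr_enorm d (u : 'rV[R]_d) : enorm u ^+ 2 = \sum_i u 0 i ^+ 2.
Proof. by rewrite sqr_sqrtr ?dot_ge0//; apply: eq_bigr => i _; rewrite expr2. Qed.

Lemma enorm_le d (u : 'rV[R]_d) c : 0 <= c ->
  (enorm u <= c) = (\sum_i u 0 i ^+ 2 <= c ^+ 2).
Proof. by move=> c0; rewrite -sqr_enorm ler_sqr // nnegrE enorm_ge0. Qed.

Lemma enorm_eq0 d (u : 'rV[R]_d) : enorm u = 0 -> u = 0.
Proof.
move=> u0; apply/rowP => i; rewrite mxE.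
have /eqP := sqr_enorm u; rewrite u0 expr0n eq_sym psumr_eq0; last first.
  by move=> j _; exact: sqr_ge0.
by move=> /allP/(_ i (mem_index_enum _)); rewrite sqrf_eq0 => /eqP.
Qed.

Lemma sum_le_sqrt2 (x y : R) : x + y <= Num.sqrt 2 * Num.sqrt (x ^+ 2 + y ^+ 2).
Proof.
rewrite -sqrtrM// (le_trans (ler_norm _))// -sqrtr_sqr ler_wsqrtr//.
by have := sqr_ge0 (x - y); nra.
Qed.

Lemma cauchy_schwarz_sum n (u v : 'I_n -> R) :
  \sum_i u i * v i <= Num.sqrt (\sum_i u i ^+ 2) * Num.sqrt (\sum_i v i ^+ 2).
Proof.
set A := \sum_i u i ^+ 2; set B := \sum_i v i ^+ 2; set C := \sum_i _.
have A0 : 0 <= A by apply: sumr_ge0 => i _; exact: sqr_ge0.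
rewrite -sqrtrM// (le_trans (ler_norm _))// -sqrtr_sqr ler_wsqrtr//.
(* Lagrange's identity: this sum of squares is [2 * (A * B - C ^+ 2)]. *)
have : 0 <= \sum_i \sum_j (u i * v j - u j * v i) ^+ 2.
  by apply: sumr_ge0 => i _; apply: sumr_ge0 => j _; exact: sqr_ge0.
have -> : \sum_i \sum_j (u i * v j - u j * v i) ^+ 2 = 2 * (A * B - C ^+ 2).
  transitivity (\sum_i (u i ^+ 2 * B + v i ^+ 2 * A - 2 * (u i * v i) * C)).
    apply: eq_bigr => i _; rewrite /A /B /C !mulr_sumr -!big_split -sumrB /=.
    by apply: eq_bigr => j _; ring.
  rewrite sumrB big_split /= -!mulr_suml -mulr_sumr -/A -/B -/C; ring.
by rewrite pmulr_rge0// subr_ge0.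
Qed.

Lemma dot_le d (u v : 'rV[R]_d) : dot u v <= enorm u * enorm v.
Proof.
have eE (w : 'rV[R]_d) : enorm w = Num.sqrt (\sum_i w 0 i ^+ 2).
  by congr Num.sqrt; apply: eq_bigr => i _; rewrite expr2.
by rewrite !eE; exact: cauchy_schwarz_sum.
Qed.

Lemma dot_row_mx m n (x x' : 'rV[R]_m) (y y' : 'rV[R]_n) :
  dot (row_mx x y) (row_mx x' y') = dot x x' + dot y y'.
Proof.
rewrite /dot big_split_ord /=; congr (_ + _); apply: eq_bigr => i _.
  by rewrite !row_mxEl.
by rewrite !row_mxEr.
Qed.

Lemma enorm_split m n (z : 'rV[R]_(m + n)) :
  enorm z = Num.sqrt (enorm (lsubmx z) ^+ 2 + enorm (rsubmx z) ^+ 2).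
Proof.
by rewrite !sqr_sqrtr ?dot_ge0// -dot_row_mx hsubmxK.
Qed.

Lemma dotDl d (u v w : 'rV[R]_d) : dot (u + v) w = dot u w + dot v w.
Proof. by rewrite /dot -big_split; apply: eq_bigr => i _; rewrite mxE mulrDl. Qed.

Lemma dotNl d (u w : 'rV[R]_d) : dot (- u) w = - dot u w.
Proof. by rewrite /dot -sumrN; apply: eq_bigr => i _; rewrite mxE mulNr. Qed.

Lemma dotNr d (u w : 'rV[R]_d) : dot u (- w) = - dot u w.
Proof. by rewrite dotC dotNl dotC. Qed.

(* Normality can only increase the pairing with [z - z']. *)
Lemma tangent_residual_ge d (F : 'rV[R]_d -> 'rV[R]_d) (S : set 'rV[R]_d)
    (z z' : 'rV[R]_d) (D : R) :
  S z' -> 0 < D -> enorm (z - z') <= D ->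
  dot (F z) (z - z') / D <= tangent_residual F S z.
Proof.
move=> Sz' D0 zz'; apply: lb_le_inf.
  (* The infimum is over a nonempty set, since 0 is normal. *)
  by exists (enorm (F z + 0)), 0 => // w _; rewrite /dot big1// => i _; rewrite mxE mul0r.
move=> _ [c cN <-]; rewrite ler_pdivrMr//.
have c_ge0 : 0 <= dot c (z - z').
  by rewrite -opprB dotNr oppr_ge0; exact: cN.
apply: le_trans (ler_wpM2l (enorm_ge0 _) zz').
by apply: le_trans (dot_le _ _); rewrite dotDl lerDl.
Qed.

(** The truncation of [w] outside [I] is the competitor in the variational inequality. It differs
    from [w] only on [I], where the Taylor part vanishes, so the regularizing term alone remains and
    has the wrong sign unless it is 0. *)
Lemma tensor_step_eq0 d (W : set 'rV[R]_d) q wb (G : 'rV[R]_d -> 'rV[R]_d) M w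
    (I : pred 'I_d) :
  0 < M -> tensor_step W q wb G M w ->
  (forall i, I i -> wb 0 i = 0) ->
  (forall k i, (k < q)%N -> I i ->
     iter_derive G (nseq k (w - wb)) wb 0 i = 0) ->
  W (\row_i (if I i then 0 else w 0 i)) ->
  forall i, I i -> w 0 i = 0.
Proof.
move=> M0 [Ww wmin] wb0 G0 Wtr i Ii.
have := wmin _ Wtr; set h := w - wb; set c := M / _ * _.
have c0 : 0 <= c.
  by rewrite mulr_ge0 ?exprn_ge0 ?enorm_ge0// divr_ge0// ltW.
have -> : dot (\sum_(k < q) k`!%:R^-1 *: iter_derive G (nseq k h) wb + c *: h)
    (\row_j (if I j then 0 else w 0 j) - w) =
    - (c * \sum_(j | I j) w 0 j ^+ 2).
  rewrite /dot mulr_sumr -sumrN [RHS]big_mkcond /=.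
  apply: eq_bigr => j _; rewrite !mxE.
  case: ifPn => Ij; last by rewrite subrr mulr0.
  rewrite summxE big1 ?wb0//; last by move=> k _; rewrite mxE G0 ?mulr0.
  by ring.
rewrite oppr_ge0 => cs.
have s0 : 0 <= \sum_(j | I j) w 0 j ^+ 2 by apply: sumr_ge0 => j _; exact: sqr_ge0.
have : c * \sum_(j | I j) w 0 j ^+ 2 == 0.
  by rewrite eq_le cs mulr_ge0.
(* If the regularizing coefficient [c] is 0, then [w = wb], which vanishes on [I]; otherwise the sum
   of squares is 0. *)
rewrite mulf_eq0 => /orP[|].
  rewrite mulf_eq0 gt_eqF ?divr_gt0 ?ltr0n ?fact_gt0//= expf_eq0 => /andP[_ /eqP].
  by move/enorm_eq0/eqP; rewrite subr_eq0 => /eqP->; exact: wb0.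
rewrite psumr_eq0; last by move=> j _; exact: sqr_ge0.
by move=> /allP/(_ i (mem_index_enum _))/implyP/(_ Ii); rewrite sqrf_eq0 => /eqP.
Qed.

End EuclideanSpace.

(** * The hard instance *)

Section HardFunction.
Variables (R : realType) (T : nat).
Implicit Types (x y h : 'rV[R]_T.+1) (z : 'rV[R]_(T.+1 + T.+1)).
Implicit Types (i j : 'I_T.+1) (b K s : R).

(** With 0 put before the first coordinate this is linear in [x]; [gap] adds the constant 1 at
    [j = 0]. *)
Definition lindiff j x : R :=
  (if j == 0%N :> nat then 0 else x 0 (inord j.-1)) - x 0 j.

Definition gap b x j : R := (j == 0%N :> nat)%:R + b * lindiff j x.

(* [hard_f] in the form [K * sum_j y_j u_j^p], where [u_j] is the rescaled
   difference of consecutive coordinates, with the value 1 put before the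
   first one. *)
Definition chain (p : nat) K b x y : R := K * \sum_j y 0 j * gap b x j ^+ p.

(** The exponent of [beta] is [p], not [p.+1]: one factor cancels against the rescaling of [y]. *)
Definition chain_coef (p : nat) (L D : R) : R :=
  L / (2 ^+ p.+1 * p`!%:R) / beta D T ^+ p.

Lemma lindiffD j x y : lindiff j (x + y) = lindiff j x + lindiff j y.
Proof. by rewrite /lindiff; case: ifP => _; rewrite !mxE; ring. Qed.

Lemma lindiffZ j s x : lindiff j (s *: x) = s * lindiff j x.
Proof. by rewrite /lindiff; case: ifP => _; rewrite !mxE; ring. Qed.

Lemma lindiffB j x y : lindiff j (x - y) = lindiff j x - lindiff j y.
Proof. by rewrite -scaleN1r lindiffD lindiffZ mulN1r. Qed.

Lemma lindiff0 x : lindiff ord0 x = - x 0 ord0.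
Proof. by rewrite /lindiff eqxx sub0r. Qed.

Lemma lindiff_lift (i : 'I_T) x :
  lindiff (lift ord0 i) x = x 0 (widen_ord (leqnSn T) i) - x 0 (lift ord0 i).
Proof.
rewrite /lindiff lift0 /=; congr (x 0 _ - _).
by apply/val_inj; rewrite /= inordK // ltnS ltnW.
Qed.

Lemma gap0 b x : gap b x ord0 = 1 - b * x 0 ord0.
Proof. by rewrite /gap lindiff0 eqxx mulrN. Qed.

Lemma gap_lift b (i : 'I_T) x : gap b x (lift ord0 i) =
  b * x 0 (widen_ord (leqnSn T) i) - b * x 0 (lift ord0 i).
Proof. by rewrite /gap lindiff_lift /= mulrBr add0r. Qed.

Lemma beta_gt0 (D : R) : 0 < D -> 0 < beta D T.
Proof. by move=> D0; rewrite divr_gt0// sqrtr_gt0 mulr_gt0. Qed.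

Lemma chain_coef_gt0 p (L D : R) : 0 < L -> 0 < D -> 0 < chain_coef p L D.
Proof.
by move=> L0 D0; rewrite !divr_gt0 ?mulr_gt0 ?exprn_gt0 ?beta_gt0 ?ltr0n ?fact_gt0.
Qed.

Lemma hard_fE p (L D : R) : 0 < D ->
  hard_f p L D T = chain p (chain_coef p L D) (beta D T).
Proof.
move=> D0; apply/funext => x; apply/funext => y.
have b0 := beta_gt0 D0.
rewrite /hard_f /fbar /chain /chain_coef; set b := beta D T in b0 *.
set A := L / _; rewrite exprS.
have bp0 : b ^+ p != 0 by rewrite gt_eqF ?exprn_gt0.
rewrite !mxE; under eq_bigr do rewrite !mxE.
have -> : b * y 0 ord0 * (1 - b * x 0 ord0) ^+ p +
   \sum_(i < T) b * y 0 (lift ord0 i) *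
     (b * x 0 (widen_ord (leqnSn T) i) - b * x 0 (lift ord0 i)) ^+ p
   = b * \sum_j y 0 j * gap b x j ^+ p.
  rewrite big_ord_recl gap0 mulrDr mulrA; congr (_ + _).
  by rewrite mulr_sumr; apply: eq_bigr => i _; rewrite gap_lift mulrA.
field; by rewrite bp0 gt_eqF.
Qed.

(** * Restrictions to lines, as polynomials in the parameter *)

Definition coord_poly y h j : {poly R} := (y 0 j)%:P + (h 0 j) *: 'X.

Definition gap_poly b x h j : {poly R} :=
  (gap b x j)%:P + (b * lindiff j h) *: 'X.

Lemma horner_coord_poly y h j s : (coord_poly y h j).[s] = (s *: h + y) 0 j.
Proof. by rewrite !hornerE !mxE mulrC addrC. Qed.

Lemma horner_gap_poly b x h j s : (gap_poly b x h j).[s] = gap b (s *: h + x) j.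
Proof. by rewrite !hornerE /gap lindiffD lindiffZ; ring. Qed.

(** Only [j = i] and [j = i + 1] contribute. The factor [lindiff j (delta_mx 0 i)] is kept so that
    linearity can recombine the sum over [i] in [residual_ge]. *)
Lemma grad_xE p K b x y i :
  grad_x (chain p K b) x y 0 i =
  K * \sum_j y 0 j * (gap b x j ^+ p.-1 * (b * lindiff j (delta_mx 0 i)) *+ p).
Proof.
rewrite mxE.
have -> : 'D_(delta_mx 0 i) (fun x => chain p K b x y) x =
   (K *: \sum_j (y 0 j) *: gap_poly b x (delta_mx 0 i) j ^+ p)^`().[0].
  apply: derive_val; apply: is_derive_line => s.
  rewrite hornerZ horner_sum; congr (_ * _); apply: eq_bigr => j _.
  by rewrite hornerZ horner_exp horner_gap_poly.
rewrite derivZ raddf_sum hornerZ horner_sum; congr (_ * _).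
apply: eq_bigr => j _; rewrite /= derivZ hornerZ deriv_exp; congr (_ * _).
rewrite hornerMn hornerM horner_exp horner_gap_poly scale0r add0r.
congr (_ *+ _); rewrite derivD derivC derivZ derivX add0r hornerZ -[1]/(1%:P).
by rewrite hornerC mulr1 mulrC.
Qed.

Lemma grad_yE p K b x y i :
  grad_y (chain p K b) x y 0 i = K * gap b x i ^+ p.
Proof.
rewrite mxE.
have -> : 'D_(delta_mx 0 i) (fun y => chain p K b x y) y =
   (K *: \sum_j (gap b x j ^+ p) *: coord_poly y (delta_mx 0 i) j)^`().[0].
  apply: derive_val; apply: is_derive_line => s.
  rewrite hornerZ horner_sum; congr (_ * _); apply: eq_bigr => j _.
  by rewrite hornerZ horner_coord_poly mulrC.
rewrite derivZ raddf_sum hornerZ horner_sum; congr (_ * _).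
have dP j : ((gap b x j ^+ p *: coord_poly y (delta_mx 0 i) j)^`()).[0] =
    gap b x j ^+ p * (j == i)%:R.
  rewrite derivZ hornerZ derivD derivC derivZ derivX add0r hornerZ.
  by rewrite -[1]/(1%:P) hornerC mulr1 mxE eqxx.
rewrite (bigD1 i)//= dP eqxx mulr1 big1 ?addr0// => j ji.
by rewrite dP (negbTE ji) mulr0.
Qed.

Definition grad_x_poly p K b x y hx hy i : {poly R} :=
  K *: \sum_j coord_poly y hy j * (gap_poly b x hx j ^+ p.-1 *+ p) *
    (b * lindiff j (delta_mx 0 i))%:P.

Definition grad_y_poly p K b x hx i : {poly R} := K *: gap_poly b x hx i ^+ p.

Lemma horner_grad_x_poly p K b x y hx hy i s :
  (grad_x_poly p K b x y hx hy i).[s] =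
  grad_x (chain p K b) (s *: hx + x) (s *: hy + y) 0 i.
Proof.
rewrite grad_xE hornerZ horner_sum; congr (_ * _); apply: eq_bigr => j _.
rewrite !hornerM hornerMn horner_coord_poly horner_exp horner_gap_poly hornerC.
by rewrite -mulrA mulrnAl.
Qed.

Lemma horner_grad_y_poly p K b x hx y i s :
  (grad_y_poly p K b x hx i).[s] = grad_y (chain p K b) (s *: hx + x) y 0 i.
Proof. by rewrite grad_yE hornerZ horner_exp horner_gap_poly. Qed.

(** * Vanishing to order [p] beyond the support (coordinates numbered from 0) *)

Definition tail_zero t x := forall i, (t <= i)%N -> x 0 i = 0.

(** The strict inequality matters: the difference at index [t] still involves coordinate [t - 1].
    Hence each step can gain one coordinate. *)
Lemma lindiff_tail t x j : tail_zero t x -> (t < j)%N -> lindiff j x = 0.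
Proof.
move=> xt tj; have j0 : (0 < j)%N := leq_ltn_trans (leq0n t) tj.
have jT := ltn_ord j.
by rewrite /lindiff gtn_eqF// !xt ?subrr ?(ltnW tj)// inordK; lia.
Qed.

Lemma lindiff_delta i j : (j < i)%N -> lindiff j (delta_mx 0 i) = 0.
Proof.
move=> ji; have jiF : (j == i) = false by rewrite -val_eqE ltn_eqF.
rewrite /lindiff !mxE eqxx jiF subr0; case: ifP => // _.
rewrite (_ : inord _ == i = false)// -val_eqE /= inordK; first by lia.
by have := ltn_ord j; lia.
Qed.

Lemma gap_poly_tail b t x h j : tail_zero t x -> (t < j)%N ->
  gap_poly b x h j = (b * lindiff j h) *: 'X.
Proof.
move=> xt tj; rewrite /gap_poly /gap (lindiff_tail xt tj) mulr0.
by rewrite gtn_eqF ?(leq_ltn_trans (leq0n t))// addr0 add0r.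
Qed.

(** Beyond index [t] the gap is a pure multiple of ['X], and it enters to the power [p]. *)
Lemma grad_y_poly_tail p K b t x hx i : tail_zero t x -> (t < i)%N ->
  exists Q, grad_y_poly p K b x hx i = Q * 'X^p.
Proof.
move=> xt ti; exists (K * (b * lindiff i hx) ^+ p)%:P.
by rewrite /grad_y_poly (gap_poly_tail b hx xt ti) exprZn scalerA mul_polyC.
Qed.

(** Terms with [j <= t] drop out because [j < i]. For [j > t] the [y]-factor supplies one ['X] and
    the power of the gap the other [p - 1]. *)
Lemma grad_x_poly_tail p K b t x y hx hy i : (0 < p)%N ->
  tail_zero t x -> tail_zero t y -> (t < i)%N ->
  exists Q, grad_x_poly p K b x y hx hy i = Q * 'X^p.
Proof.
move=> p0 xt yt ti.
exists (K *: \sum_(j < T.+1 | (t < j)%N) (hy 0 j)%:P * ((b * lindiff j hx) ^+ p.-1 *+ p)%:P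
   * (b * lindiff j (delta_mx 0 i))%:P).
rewrite /grad_x_poly -scalerAl; congr (_ *: _).
rewrite mulr_suml [RHS]big_mkcond /=; apply: eq_bigr => j _.
case: ltnP => [tj|jt]; last first.
  by rewrite lindiff_delta ?mulr0// (leq_ltn_trans jt).
rewrite /coord_poly yt ?(ltnW tj)// add0r (gap_poly_tail b hx xt tj) exprZn.
rewrite -[p in 'X^p](prednK p0) exprS polyCMn -!mul_polyC; ring.
Qed.

End HardFunction.

(** * Supports of the iterates *)

Section FeasibleSets.
Variables (R : realType) (T : nat) (D : R).
Hypothesis D_gt0 : 0 < D.
Implicit Types (x y : 'rV[R]_T.+1) (i j : 'I_T.+1).

Let b_gt0 : 0 < beta D T := beta_gt0 T D_gt0.

Lemma XbarP x : Xbar T x <->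
  (forall i j, (i <= j)%N -> x 0 j <= x 0 i) /\ (forall i, 0 <= x 0 i <= 1).
Proof.
split=> [[x0 xS x1]|[xle x01]]; last first.
  split; [by have /andP[] := x01 ord_max | | by have /andP[] := x01 ord0].
  by move=> i; apply: xle; rewrite lift0 /= leqnSn.
have xle k : forall i j, (j = i + k :> nat)%N -> x 0 j <= x 0 i.
  elim: k => [|k IH] i j jE.
    by rewrite (_ : j = i)//; apply: ord_inj; rewrite jE addn0.
  have jT : (j.-1 < T)%N by have := ltn_ord j; lia.
  rewrite (_ : j = lift ord0 (Ordinal jT)); last first.
    by apply: ord_inj; rewrite lift0 /=; lia.
  by apply: le_trans (xS _) _; apply: IH => /=; lia.
have xle' i j : (i <= j)%N -> x 0 j <= x 0 i.
  by move=> ij; apply: (xle (j - i)%N); rewrite subnKC.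
split=> // i; apply/andP; split.
  by apply: le_trans x0 _; apply: xle'; rewrite -ltnS ltn_ord.
by apply: le_trans x1; apply: xle'.
Qed.

Lemma hard_XP x : hard_X D T x <->
  (forall i j, (i <= j)%N -> x 0 j <= x 0 i) /\
  (forall i, 0 <= x 0 i <= (beta D T)^-1).
Proof.
split=> [/XbarP[xle x01]|[xle x01]].
  split=> [i j /xle|i]; first by rewrite !mxE ler_pM2l.
  have := x01 i; rewrite mxE -ler_pdivlMl// mulr1.
  by rewrite pmulr_rge0.
apply/XbarP; split=> [i j /xle|i]; first by rewrite !mxE ler_pM2l.
by rewrite mxE -ler_pdivlMl// mulr1 pmulr_rge0.
Qed.

Lemma hard_YP y : hard_Y D T y <-> forall i, 0 <= y 0 i <= (beta D T)^-1.
Proof.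
by split=> yP i; have := yP i; rewrite mxE -ler_pdivlMl// mulr1 pmulr_rge0.
Qed.

Lemma lindiff_ge0 x j : (forall i j, (i <= j)%N -> x 0 j <= x 0 i) ->
  (j != ord0) -> 0 <= lindiff j x.
Proof.
rewrite -val_eqE /lindiff => xle /negbTE /= ->; rewrite subr_ge0 xle//.
by have := ltn_ord j; move=> jT; rewrite inordK; lia.
Qed.

Lemma gap_ge0 x j : hard_X D T x -> 0 <= gap (beta D T) x j.
Proof.
move=> /hard_XP[xle x01]; have [->|j0] := eqVneq j ord0.
  rewrite gap0 subr_ge0 -ler_pdivlMl// mulr1.
  by have /andP[] := x01 ord0.
by rewrite /gap addr_ge0// mulr_ge0 ?lindiff_ge0// ltW.
Qed.

(** Zeroing an upward closed set of indices keeps the coordinates nonincreasing, so the truncation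
    is an admissible competitor in [tensor_step_eq0]. *)
Lemma hard_X_trunc (I : pred 'I_T.+1) x :
  (forall i j, (i <= j)%N -> I i -> I j) ->
  hard_X D T x -> hard_X D T (\row_i (if I i then 0 else x 0 i)).
Proof.
move=> Imono /hard_XP[xle x01]; apply/hard_XP; split=> [i j ij|i].
  rewrite !mxE; have := Imono _ _ ij; case: (I i) => [->//|_].
  by case: ifP => _; [have /andP[] := x01 i|exact: xle].
by rewrite mxE; case: ifP => //; rewrite lexx invr_ge0 ltW.
Qed.

Lemma hard_Y_trunc (I : pred 'I_T.+1) y :
  hard_Y D T y -> hard_Y D T (\row_i (if I i then 0 else y 0 i)).
Proof.
move=> /hard_YP y01; apply/hard_YP => i.
by rewrite mxE; case: ifP => //; rewrite lexx invr_ge0 ltW.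
Qed.

End FeasibleSets.

Section ZeroChain.
Variables (R : realType) (T p : nat) (L D : R).
Hypotheses (p_gt0 : (0 < p)%N) (D_gt0 : 0 < D).
Implicit Types (x y : 'rV[R]_T.+1).

Let b := beta D T.
Let K := chain_coef T p L D.

Lemma tail_zero_leq t t' x : (t <= t')%N -> tail_zero t x -> tail_zero t' x.
Proof. by move=> tt' xt i /(leq_trans tt'); exact: xt. Qed.

Lemma tail_zero_span t (x : nat -> 'rV[R]_T.+1) v :
  (forall s, (s <= t)%N -> tail_zero t (x s)) ->
  v \in <<mkseq x t.+1>>%VS -> tail_zero t v.
Proof.
move=> xt; rewrite -[mkseq x t.+1]/(tval [tuple of mkseq x t.+1]).
move=> /coord_span -> i ti; rewrite summxE big1// => k _.
rewrite mxE /= nth_mkseq ?(ltn_ord k)//.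
by rewrite xt ?mulr0// -ltnS.
Qed.

Lemma tensor_step_x q t xb yb M w : (q <= p)%N -> 0 < M ->
  tail_zero t xb -> tail_zero t yb ->
  tensor_step (hard_X D T) q xb (fun x => grad_x (chain p K b) x yb) M w ->
  tail_zero t.+1 w.
Proof.
move=> qp M0 xbt ybt wP i ti.
apply: (tensor_step_eq0 M0 wP (I := fun j : 'I_T.+1 => (t < j)%N)) => //.
- by move=> j tj; apply: xbt; exact: ltnW.
- move=> k j kq tj; set h := w - xb.
  (* Only [x] moves in this step, so the direction in [y] is 0. *)
  have [Q PQ] := grad_x_poly_tail K b h 0 p_gt0 xbt ybt tj.
  apply: (@iter_derive_line_eq0 _ _ _ _ _ _ _ _
    (fun x i => grad_x_poly p K b x yb h 0 i) Q p).
  + by move=> x i' s; rewrite horner_grad_x_poly scaler0 add0r.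
  + exact: PQ.
  + exact: leq_trans kq qp.
- case: wP => Ww _; apply: hard_X_trunc => // j j' jj' /leq_trans; exact.
Qed.

Lemma tensor_step_y q t xb yb M w : (q <= p)%N -> 0 < M ->
  tail_zero t xb -> tail_zero t yb ->
  tensor_step (hard_Y D T) q yb (fun y => - grad_y (chain p K b) xb y) M w ->
  tail_zero t.+1 w.
Proof.
move=> qp M0 xbt ybt wP i ti.
apply: (tensor_step_eq0 M0 wP (I := fun j : 'I_T.+1 => (t < j)%N)) => //.
- by move=> j tj; apply: ybt; exact: ltnW.
- move=> k j kq tj; set h := w - yb.
  (* [grad_y] is independent of [y]: the direction in [x] is 0 and the restriction is a constant
     polynomial. *)
  have [Q PQ] := grad_y_poly_tail p K b 0 xbt tj.
  apply: (@iter_derive_line_eq0 _ _ _ _ _ _ _ _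
    (fun y i => - grad_y_poly p K b xb 0 i) (- Q) p).
  + move=> y i' s; rewrite mxE hornerN (@horner_grad_y_poly _ _ _ _ _ _ _ (s *: h + y)).
    by rewrite scaler0 add0r.
  + by rewrite PQ mulNr.
  + exact: leq_trans kq qp.
- by case: wP => Ww _; apply: hard_Y_trunc.
Qed.

Lemma tensor_step_xy q t xb yb M x y : (q <= p)%N -> 0 < M ->
  tail_zero t xb -> tail_zero t yb ->
  tensor_step (hard_Z D T) q (row_mx xb yb) (saddle_op (chain p K b)) M
    (row_mx x y) ->
  tail_zero t.+1 x /\ tail_zero t.+1 y.
Proof.
move=> qp M0 xbt ybt wP.
(* [I] marks the tails of both halves; [P] restricts both blocks of the operator to a line moving
   [x] and [y] together. *)
pose I (j : 'I_(T.+1 + T.+1)) :=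
  match fintype.split j with inl i => (t < i)%N | inr i => (t < i)%N end.
pose P (h z : 'rV[R]_(T.+1 + T.+1)) (j : 'I_(T.+1 + T.+1)) : {poly R} :=
  match fintype.split j with
  | inl i => grad_x_poly p K b (lsubmx z) (rsubmx z) (lsubmx h) (rsubmx h) i
  | inr i => - grad_y_poly p K b (lsubmx z) (lsubmx h) i
  end.
have Il i : I (lshift _ i) = (t < i)%N by rewrite /I (unsplitK (inl i)).
have Ir i : I (rshift _ i) = (t < i)%N by rewrite /I (unsplitK (inr i)).
have w0 : forall j, I j -> row_mx x y 0 j = 0.
  apply: (tensor_step_eq0 M0 wP) => [j|k j kq|].
  - case: (split_ordP j) => i ->.
      by rewrite Il (row_mxEl xb yb) => ti; apply: xbt; exact: ltnW.
    by rewrite Ir (row_mxEr xb yb) => ti; apply: ybt; exact: ltnW.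
  - set h := row_mx x y - _.
    have GP z i s : saddle_op (chain p K b) (s *: h + z) 0 i = (P h z i).[s].
      rewrite /P /saddle_op; case: (split_ordP i) => i' ->.
        rewrite (row_mxEl (grad_x _ _ _)) horner_grad_x_poly.
        by rewrite !linearD !linearZ.
      rewrite (row_mxEr (grad_x _ _ _)) mxE hornerN.
      by rewrite (@horner_grad_y_poly _ _ _ _ _ _ _ (rsubmx (s *: h + z)))
        !linearD !linearZ.
    case: (split_ordP j) => i -> ti.
      have [Q PQ] := grad_x_poly_tail K b (lsubmx h) (rsubmx h) p_gt0 xbt ybt
        (etrans (esym (Il i)) ti).
      apply: (iter_derive_line_eq0 (Q := Q) GP); last exact: leq_trans kq qp.
      by rewrite /P (unsplitK (inl i)) row_mxKl row_mxKr.
    have [Q PQ] := grad_y_poly_tail p K b (lsubmx h) xbt (etrans (esym (Ir i)) ti).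
    apply: (iter_derive_line_eq0 (Q := - Q) GP); last exact: leq_trans kq qp.
    by rewrite /P (unsplitK (inr i)) row_mxKl PQ mulNr.
  - case: wP => -[]; rewrite row_mxKl row_mxKr => Xx Yy _.
    split.
      rewrite (_ : lsubmx _ = \row_i (if (t < i)%N then 0 else x 0 i)).
        by apply: hard_X_trunc => // j j' jj' /leq_trans; exact.
      by apply/rowP => i; rewrite 2![LHS]mxE [RHS]mxE Il (row_mxEl x y).
    rewrite (_ : rsubmx _ = \row_i (if (t < i)%N then 0 else y 0 i)).
      exact: hard_Y_trunc.
    by apply/rowP => i; rewrite 2![LHS]mxE [RHS]mxE Ir (row_mxEr x y).
split=> i ti.
  by rewrite -(row_mxEl x y) w0 ?Il.
by rewrite -(row_mxEr x y) w0 ?Ir.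
Qed.

(* Each oracle call extends the supports by at most one coordinate. *)
Lemma run_tail_zero N (x y : nat -> 'rV[R]_T.+1) :
  tensor_algorithm_run p (hard_X D T) (hard_Y D T) (hard_f p L D T) N x y ->
  forall t, (t <= N)%N ->
    [/\ hard_X D T (x t), hard_Y D T (y t), tail_zero t (x t) & tail_zero t (y t)].
Proof.
(* Strong induction, because a base point may combine all earlier iterates. *)
rewrite hard_fE// -/b -/K => -[x0 y0 run]; elim/ltn_ind => -[_ _|t IH tN].
  have b0 := ltW (beta_gt0 T D_gt0).
  rewrite x0 y0; split.
  - by apply/hard_XP => //; split=> [i j _|i]; rewrite !mxE ?lexx ?invr_ge0.
  - by apply/hard_YP => // i; rewrite mxE lexx invr_ge0.
  - by move=> i; rewrite mxE.
  - by move=> i; rewrite mxE.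
have [Xt Yt xt yt] := IH t (ltnSn t) (ltnW tN).
have xs s : (s <= t)%N -> tail_zero t (x s).
  by move=> st; have [_ _ /(tail_zero_leq st)] := IH s st (leq_trans st (ltnW tN)).
have ys s : (s <= t)%N -> tail_zero t (y s).
  by move=> st; have [_ _ _ /(tail_zero_leq st)] := IH s st (leq_trans st (ltnW tN)).
have [xb [yb [q [M [/(tail_zero_span xs) xbt /(tail_zero_span ys) ybt]]]]] :=
  run t tN.
move=> /andP[_ qp] M0 [[st ->]|[st ->]|st].
- split=> //; [by case: st | | exact: tail_zero_leq yt].
  exact: tensor_step_x st.
- split=> //; [by case: st | exact: tail_zero_leq xt | ].
  exact: tensor_step_y st.
- have [] := tensor_step_xy qp M0 xbt ybt st; case: st => -[].
  by rewrite row_mxKl row_mxKr => Xx Yy _ xt' yt'; split.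
Qed.

End ZeroChain.

(** * Lower bound on the tangent residual *)

Section ResidualLowerBound.
Variable R : realType.

(** The graph of the power function lies above its tangent at [m]. Multiplying the case [p] by [t]
    leaves the remainder [p * m ^ (p - 1) * (t - m) ^ 2]. *)
Lemma exprn_tangent_le (p : nat) (m t : R) : (0 < p)%N -> 0 <= m -> 0 <= t ->
  m ^+ p + p%:R * m ^+ p.-1 * (t - m) <= t ^+ p.
Proof.
case: p => // p _ m0 t0; elim: p => [|p IH] /=.
  by rewrite expr0 !expr1 !mul1r addrC subrK.
have := ler_wpM2l t0 IH; rewrite -exprS; apply: le_trans.
rewrite -subr_ge0 [X in 0 <= X](_ : _ = p.+1%:R * m ^+ p * (t - m) ^+ 2).
  by rewrite mulr_ge0 ?sqr_ge0// mulr_ge0 ?ler0n ?exprn_ge0.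
by rewrite /= -[in p.+2%:R]addn1 natrD !exprS expr0; ring.
Qed.

Lemma enorm_le_box d (u : 'rV[R]_d) (c : R) : 0 <= c ->
  (forall i, `|u 0 i| <= c) -> enorm u <= Num.sqrt d%:R * c.
Proof.
move=> c0 uc; rewrite enorm_le ?mulr_ge0 ?sqrtr_ge0// exprMn sqr_sqrtr//.
rewrite (le_trans (y := \sum_(i < d) c ^+ 2))//.
  by apply: ler_sum => i _; rewrite -[u 0 i ^+ 2]real_normK ?num_real ?ler_sqr.
by rewrite sumr_const card_ord mulr_natl.
Qed.

(** The exponent is [(p + 1) / 2 + (p - 1)]: the first part comes from [beta ^+ p.+1], the second
    from [sum_gap_exp_ge]. *)
Lemma powR_half_odd (n p : nat) : (0 < p)%N ->
  n%:R `^ ((3 * p%:R - 1) / 2) =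
  Num.sqrt n%:R ^+ p.+1 * n%:R ^+ p.-1 :> R.
Proof.
case: p => // p _.
have -> : (3 * p.+1%:R - 1) / 2 = 2^-1 * (p.+2 + 2 * p)%:R :> R.
  by rewrite natrD natrM -[p.+2]addn2 -[p.+1]addn1 !natrD; field.
rewrite powRrM powR_mulrn ?powR_ge0// powR12_sqrt// exprD exprM.
by rewrite sqr_sqrtr.
Qed.

Variable T : nat.
Implicit Types (x y : 'rV[R]_T.+1) (i j : 'I_T.+1).

Lemma lindiff_sum x j :
  lindiff j x = \sum_i x 0 i * lindiff j (delta_mx 0 i).
Proof.
rewrite {1}[x]row_sum_delta (big_morph (lindiff j) (@lindiffD _ _ j) (_ : _ = 0)).
  by apply: eq_bigr => i _; rewrite lindiffZ.
by rewrite -(scale0r 0) lindiffZ mul0r.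
Qed.

Lemma sum_gap b x : \sum_j gap b x j = 1 - b * x 0 ord_max.
Proof.
rewrite big_ord_recl gap0.
under eq_bigr do rewrite gap_lift.
have -> : \sum_(i < T) (b * x 0 (widen_ord (leqnSn T) i) - b * x 0 (lift ord0 i))
   = \sum_(0 <= i < T) (- (b * x 0 (inord i.+1)) - - (b * x 0 (inord i))).
  rewrite big_mkord; apply: eq_bigr => i _; rewrite opprK [RHS]addrC.
  congr (b * x 0 _ - b * x 0 _); apply: ord_inj.
    by rewrite /= inordK // ltnS ltnW.
  by rewrite lift0 inordK// ltnS.
rewrite telescope_sumr// opprK addrACA.
rewrite (_ : inord T = ord_max); last by apply: ord_inj; rewrite inordK.
rewrite (_ : inord 0 = ord0); last by apply: ord_inj; rewrite inordK.
ring.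
Qed.

Variables (p : nat) (L D : R).
Hypotheses (p_gt0 : (0 < p)%N) (L_gt0 : 0 < L) (D_gt0 : 0 < D).

Let b := beta D T.
Let K := chain_coef T p L D.
Let b_gt0 : 0 < b := beta_gt0 T D_gt0.

(** Tangents are taken at the mean [m] of the gaps; as the gaps sum to 1, the linear terms
    cancel. *)
Lemma sum_gap_exp_ge x : hard_X D T x -> x 0 ord_max = 0 ->
  (T.+1%:R ^+ p.-1)^-1 <= \sum_j gap b x j ^+ p.
Proof.
move=> Xx xT; set m : R := T.+1%:R^-1.
have m0 : 0 <= m by rewrite invr_ge0.
apply: le_trans (ler_sum _ (fun j _ =>
  exprn_tangent_le p_gt0 m0 (gap_ge0 D_gt0 j Xx))).
rewrite big_split /= -mulr_sumr sumrB sum_gap xT mulr0 subr0.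
rewrite !sumr_const card_ord -[m *+ _]mulr_natl mulfV ?pnatr_eq0// subrr mulr0 addr0.
rewrite -[m ^+ p *+ _]mulr_natl -[in m ^+ p](prednK p_gt0) exprS mulrA mulfV ?pnatr_eq0// mul1r.
by rewrite exprVn.
Qed.

(** [hard_Z] lies in a cube of side [b^-1] in dimension [2 * T.+1], and [beta] is chosen so that the
    diagonal is [D]. *)
Lemma hard_Z_dist_le z z' : hard_Z D T z -> hard_Z D T z' -> enorm (z - z') <= D.
Proof.
have box (u v : 'rV[R]_T.+1) i : 0 <= u 0 i <= b^-1 -> 0 <= v 0 i <= b^-1 ->
    `|u 0 i - v 0 i| <= b^-1.
  by move=> /andP[? ?] /andP[? ?]; rewrite ler_norml; apply/andP; split; lra.
move=> [/(hard_XP D_gt0)[_ x01] /(hard_YP D_gt0) y01].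
move=> [/(hard_XP D_gt0)[_ x01'] /(hard_YP D_gt0) y01'].
have -> : D = Num.sqrt (T.+1 + T.+1)%:R * b^-1.
  rewrite /b /beta /diam_bar addnn -mul2n natrM invf_div mulrCA mulfV ?mulr1//
    gt_eqF// sqrtr_gt0 mulr_gt0.
apply: enorm_le_box; first by rewrite invr_ge0 ltW.
move=> i; rewrite !mxE; case: (split_ordP i) => j ->.
  by have := box _ _ j (x01 j) (x01' j); rewrite !mxE.
by have := box _ _ j (y01 j) (y01' j); rewrite !mxE.
Qed.

(** Paired with [z - (c, c)], the [x]-block gives [p * K * sum_j y_j u_j ^ p] and the [y]-block
    gives [- K * sum_j y_j u_j ^ p + K / b * sum_j u_j ^ p]. Since [p >= 1] and [y_j >= 0], the last
    sum is a lower bound. *)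
Lemma residual_ge x y : hard_X D T x -> hard_Y D T y -> x 0 ord_max = 0 ->
  K / b * (T.+1%:R ^+ p.-1)^-1 / D <=
  tangent_residual (hard_F p L D T) (hard_Z D T) (row_mx x y).
Proof.
move=> Xx Yy xT.
pose c : 'rV[R]_T.+1 := const_mx b^-1.
have Xc : hard_X D T c.
  by apply/hard_XP => //; split=> [i j _|i]; rewrite !mxE// invr_ge0 lexx andbT ltW.
have Yc : hard_Y D T c.
  by apply/hard_YP => // i; rewrite !mxE// invr_ge0 lexx andbT ltW.
have Zz : hard_Z D T (row_mx x y) by split; rewrite ?row_mxKl ?row_mxKr.
have Zc : hard_Z D T (row_mx c c) by split; rewrite ?row_mxKl ?row_mxKr.
apply: le_trans (tangent_residual_ge (hard_F p L D T) Zc D_gt0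
  (hard_Z_dist_le Zz Zc)).
rewrite ler_pM2r ?invr_gt0// /hard_F hard_fE// -/b -/K /saddle_op.
rewrite opp_row_mx add_row_mx dot_row_mx row_mxKl row_mxKr.
have K0 : 0 < K by exact: chain_coef_gt0.
have gapc j : gap b c j = 0.
  rewrite /gap /lindiff !mxE mulrBr; case: ifP => _ /=.
    by rewrite mulr0 sub0r mulfV ?subrr// gt_eqF.
  by rewrite subrr add0r.
have -> : dot (grad_x (chain p K b) x y) (x - c) =
    K * \sum_j p%:R * (y 0 j * gap b x j ^+ p).
  rewrite /dot mulr_sumr.
  under eq_bigr do rewrite grad_xE -mulrA mulr_suml mulr_sumr.
  rewrite exchange_big; apply: eq_bigr => j _ /=.
  (* All gaps of [c] vanish, so [b * lindiff j (x - c)] is the gap of [x], as in Euler's identity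
     for homogeneous functions. *)
  have -> : gap b x j ^+ p = gap b x j ^+ p.-1 * (b * lindiff j (x - c)).
    rewrite lindiffB mulrBr -{1}(prednK p_gt0) exprSr; congr (_ * _).
    by rewrite -[LHS]subr0 -(gapc j) /gap; ring.
  rewrite [lindiff j (x - c)]lindiff_sum !mulr_sumr; apply: eq_bigr => i _.
  by rewrite -mulr_natl; ring.
have -> : dot (- grad_y (chain p K b) x y) (y - c) =
    - (K * \sum_j y 0 j * gap b x j ^+ p) + K / b * \sum_j gap b x j ^+ p.
  rewrite /dot !mulr_sumr -sumrN -big_split; apply: eq_bigr => j _ /=.
  by rewrite mxE grad_yE !mxE; field; rewrite gt_eqF.
rewrite -mulr_sumr addrA.
have S0 : 0 <= K * \sum_j y 0 j * gap b x j ^+ p.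
  rewrite mulr_ge0 ?(ltW K0)// sumr_ge0// => j _.
  rewrite mulr_ge0 ?exprn_ge0 ?(gap_ge0 D_gt0)//.
  by have /(hard_YP D_gt0)/(_ j)/andP[] := Yy.
have Kb0 : 0 < K / b by exact: divr_gt0.
have := sum_gap_exp_ge Xx xT; rewrite -(ler_pM2l Kb0); set S := _ * \sum_j _ ^+ p.
have : K * \sum_j y 0 j * gap b x j ^+ p <=
    K * (p%:R * \sum_j y 0 j * gap b x j ^+ p).
  by rewrite mulrCA ler_peMl// ler1n.
by move=> h1 h2; apply: le_trans h2 _; rewrite lerDr subr_ge0.
Qed.

(** [2 ^+ q.+1 * q!] is the normalization of [fbar], and [Num.sqrt 2 ^+ q.+1] comes from
    [beta ^+ q.+1]. *)
Definition residual_coef (q : nat) : R :=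
  (2 ^+ q.+1 * q`!%:R * Num.sqrt 2 ^+ q.+1)^-1.

Lemma residual_coef_gt0 q : 0 < residual_coef q.
Proof.
by rewrite invr_gt0 !mulr_gt0 ?exprn_gt0 ?ltr0n ?fact_gt0// sqrtr_gt0.
Qed.

Lemma run_residual_ge N (x y : nat -> 'rV[R]_T.+1) : (N <= T)%N ->
  tensor_algorithm_run p (hard_X D T) (hard_Y D T) (hard_f p L D T) N x y ->
  residual_coef p * (L * D ^+ p / T.+1%:R `^ ((3 * p%:R - 1) / 2)) <=
  tangent_residual (hard_F p L D T) (hard_Z D T) (row_mx (x N) (y N)).
Proof.
move=> NT /(run_tail_zero p_gt0 D_gt0)/(_ N (leqnn N))[Xx Yy xN _].
(* [ord_max] has index [T >= N], so it is still outside the support. *)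
apply: le_trans (residual_ge Xx Yy (xN ord_max NT)).
rewrite powR_half_odd// le_eqVlt; apply/orP; left; apply/eqP.
rewrite /K /b /chain_coef /beta /diam_bar /residual_coef sqrtrM//.
rewrite !expr_div_n !exprMn !exprS.
have s2 : Num.sqrt 2 != 0 :> R by rewrite gt_eqF// sqrtr_gt0.
have sT : Num.sqrt T.+1%:R != 0 :> R by rewrite gt_eqF// sqrtr_gt0.
field.
by rewrite !expf_neq0 ?s2 ?sT ?pnatr_eq0 -?lt0n ?fact_gt0 ?gt_eqF.
Qed.

End ResidualLowerBound.

(** * Lipschitz continuity of the p-th derivative *)

Section DifferenceBounds.
Variables (R : realType) (T : nat).
Implicit Types (x : 'rV[R]_T.+1) (j : 'I_T.+1).

Lemma lindiff_le x j : `|lindiff j x| <= Num.sqrt 2 * enorm x.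
Proof.
rewrite -ler_sqr ?nnegrE ?mulr_ge0 ?sqrtr_ge0 ?enorm_ge0//.
rewrite exprMn sqr_sqrtr// real_normK ?num_real// sqr_enorm.
case: (unliftP ord0 j) => [i ->|->].
  rewrite lindiff_lift (bigD1 (lift ord0 i))//= (bigD1 (widen_ord (leqnSn T) i)) /=.
    have : 0 <= \sum_(k < T.+1 | (k != lift ord0 i) && (k != widen_ord (leqnSn T) i))
      x 0 k ^+ 2 by apply: sumr_ge0 => k _; exact: sqr_ge0.
    by have := sqr_ge0 (x 0 (lift ord0 i) + x 0 (widen_ord (leqnSn T) i)); nra.
  by rewrite -val_eqE /= /bump /= ltn_eqF.
rewrite lindiff0 sqrrN (bigD1 ord0)//=.
have : 0 <= \sum_(k < T.+1 | k != ord0) x 0 k ^+ 2.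
  by apply: sumr_ge0 => k _; exact: sqr_ge0.
by have := sqr_ge0 (x 0 ord0); lra.
Qed.

(** Each square of a difference is at most twice the sum of the two squares, and a coordinate enters
    at most two differences. *)
Lemma sum_sqr_lindiff_le x : \sum_j lindiff j x ^+ 2 <= 4 * enorm x ^+ 2.
Proof.
set S := enorm x ^+ 2; rewrite big_ord_recl lindiff0 sqrrN.
have S1 : S = x 0 ord0 ^+ 2 + \sum_(i < T) x 0 (lift ord0 i) ^+ 2.
  by rewrite /S sqr_enorm big_ord_recl.
have S2 : S = \sum_(i < T) x 0 (widen_ord (leqnSn T) i) ^+ 2 + x 0 ord_max ^+ 2.
  by rewrite /S sqr_enorm big_ord_recr.
have : \sum_(i < T) lindiff (lift ord0 i) x ^+ 2 <=
    2 * (\sum_(i < T) x 0 (widen_ord (leqnSn T) i) ^+ 2 +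
         \sum_(i < T) x 0 (lift ord0 i) ^+ 2).
  rewrite -big_split mulr_sumr; apply: ler_sum => i _ /=; rewrite lindiff_lift.
  by have := sqr_ge0 (x 0 (lift ord0 i) + x 0 (widen_ord (leqnSn T) i)); nra.
by have := sqr_ge0 (x 0 ord0); have := sqr_ge0 (x 0 ord_max); lra.
Qed.

Lemma sum_norm_le n (u v : 'I_n -> R) :
  \sum_i `|u i| * `|v i| <=
  Num.sqrt (\sum_i u i ^+ 2) * Num.sqrt (\sum_i v i ^+ 2).
Proof.
apply: le_trans (cauchy_schwarz_sum _ _) _.
under eq_bigr do rewrite real_normK ?num_real//.
by under [in X in _ * X]eq_bigr do rewrite real_normK ?num_real//.
Qed.

End DifferenceBounds.

Section LipschitzDerivatives.
Variables (R : realType) (T p : nat) (K b : R).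
Hypothesis (p_gt0 : (0 < p)%N) (b_gt0 : 0 < b).
Implicit Types (z v : 'rV[R]_(T.+1 + T.+1)) (vs : seq 'rV[R]_(T.+1 + T.+1)).
Implicit Types (j : 'I_T.+1).

(** The derivative of [gap b (lsubmx z) j] in [z] along [v]. *)
Let slope j v := b * lindiff j (lsubmx v).

Let slope_prod j vs := \prod_(v <- vs) slope j v.

(* Sum over the positions of [v] in [vs] of its [y_j]-component times the
   slopes along the other directions. *)
Let mixed_prod j := fix mixed_prod vs : R :=
  if vs is v :: vs' then
    rsubmx v 0 j * slope_prod j vs' + slope j v * mixed_prod vs'
  else 0.

(** Leibniz formula: as [y_j] is linear, at most one direction differentiates it. For empty [vs] the
    truncated predecessor is harmless, [mixed_prod] being 0. *)
Let chain_derive vs z : R :=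
  K * \sum_j (p ^_ (size vs))%:R *
      (rsubmx z 0 j * slope_prod j vs * gap b (lsubmx z) j ^+ (p - size vs)) +
  K * \sum_j (p ^_ (size vs).-1)%:R *
      (mixed_prod j vs * gap b (lsubmx z) j ^+ (p - size vs).+1).

Lemma iter_derive_chain vs : (size vs <= p)%N ->
  iter_derive (uncurry_mx (chain p K b)) vs = chain_derive vs.
Proof.
elim: vs => [_|v vs IH /= svs].
  apply/funext => z; rewrite /chain_derive /= /uncurry_mx subn0 ffactn0.
  rewrite [X in _ + K * X]big1 ?mulr0 ?addr0 => [|j _]; last by rewrite mul0r mulr0.
  congr (K * _); apply: eq_bigr => j _.
  by rewrite /slope_prod big_nil mulr1 mul1r.
rewrite IH ?(ltnW svs)//; apply/funext => z; set k := size vs in svs *.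
pose Y j := coord_poly (rsubmx z) (rsubmx v) j.
pose G j := gap_poly b (lsubmx z) (lsubmx v) j.
have -> : 'D_v (chain_derive vs) z =
   (K *: \sum_j (p ^_ k)%:R *: (slope_prod j vs *: (Y j * G j ^+ (p - k))) +
    K *: \sum_j (p ^_ k.-1)%:R *: (mixed_prod j vs *: G j ^+ (p - k).+1))^`().[0].
  apply: derive_val; apply: is_derive_line => s.
  rewrite hornerD !hornerZ !horner_sum /chain_derive; congr (K * _ + K * _);
    apply: eq_bigr => j _; rewrite !hornerZ ?hornerM horner_exp horner_gap_poly
      ?horner_coord_poly !linearD !linearZ //=.
  ring.
have Y0 j : (Y j).[0] = rsubmx z 0 j.
  by rewrite horner_coord_poly scale0r add0r.
have G0 j : (G j).[0] = gap b (lsubmx z) j.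
  by rewrite horner_gap_poly scale0r add0r.
have dY j : (Y j)^`() = (rsubmx v 0 j)%:P.
  by rewrite derivD derivC derivZ derivX add0r alg_polyC.
have dG j : (G j)^`() = (slope j v)%:P.
  by rewrite derivD derivC derivZ derivX add0r alg_polyC.
rewrite derivD !derivZ hornerD !hornerZ !raddf_sum !horner_sum /chain_derive /=.
rewrite -!mulrDr -!big_split; congr (K * _); apply: eq_bigr => j _ /=.
rewrite !derivZ derivM !deriv_exp !hornerZ hornerD !hornerMn !hornerM.
rewrite hornerMn !hornerM !horner_exp dY dG !hornerC Y0 G0 -/k /=.
rewrite /slope_prod big_cons -/(slope_prod j vs) subnSK// ffactnSr natrM.
have kp : (p - k = (p - k.+1).+1)%N by rewrite subnSK.
rewrite kp /=.
(* The recursion for falling factorials one step back; for empty [vs] both sides are 0. *)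
have E : (p ^_ k)%:R * mixed_prod j vs =
   (p ^_ k.-1)%:R * (p - k.+1).+2%:R * mixed_prod j vs.
  case: (vs) @k svs {kp} => [|w vs'] /= svs; first by rewrite !mulr0.
  by rewrite ffactnSr natrM; congr (_ * _%:R * _); lia.
have natE (x : R) n : x *+ n = x * n%:R by rewrite mulr_natr.
rewrite -/(slope j v) 2!(natE (slope j v * _)) exprS.
move: E; generalize (mixed_prod j vs) (slope_prod j vs) (slope j v)
  (gap b (lsubmx z) j) (rsubmx z 0 j) (rsubmx v 0 j)
  ((p ^_ k)%:R : R) ((p ^_ k.-1)%:R : R).
generalize (p - k.+1)%N => n M A s u y e a c.
generalize (n.+1%:R : R) (n.+2%:R : R) => n1 n2 E.
transitivity (a * (A * (e * (u * u ^+ n) + y * (s * u ^+ n) * n1)) +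
  a * M * s * (u * u ^+ n)); last by ring.
by rewrite E; ring.
Qed.

(** * Norm estimates for the multilinear forms *)

Let C := b * Num.sqrt 2.
Let cx v := enorm (lsubmx v).
Let cy v := enorm (rsubmx v).

Let C_ge0 : 0 <= C.
Proof. by rewrite mulr_ge0 ?sqrtr_ge0// ltW. Qed.

Let prod_cx_ge0 vs : 0 <= \prod_(v <- vs) cx v.
Proof. by apply: prodr_ge0 => v _; exact: enorm_ge0. Qed.

(** [mixed_prod] with components and slopes replaced by the norms of the [y]- and [x]-blocks. *)
Let mixed_norm := fix mixed_norm vs : R :=
  if vs is v :: vs' then cy v * \prod_(w <- vs') cx w + cx v * mixed_norm vs'
  else 0.

Let mixed_norm_ge0 vs : 0 <= mixed_norm vs.
Proof.
elim: vs => //= v vs IH; rewrite addr_ge0// mulr_ge0//; exact: enorm_ge0.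
Qed.

Let slope_le j v : `|slope j v| <= C * cx v.
Proof.
rewrite normrM gtr0_norm// /C -mulrA ler_pM2l//; exact: lindiff_le.
Qed.

Let sum_sqr_slope_le v :
  Num.sqrt (\sum_j slope j v ^+ 2) <= Num.sqrt 2 * (C * cx v).
Proof.
have -> : Num.sqrt 2 * (C * cx v) = Num.sqrt ((2 * b * cx v) ^+ 2).
  rewrite sqrtr_sqr ger0_norm; last by rewrite !mulr_ge0 ?enorm_ge0// ltW.
  by rewrite -[2 in RHS](@sqr_sqrtr _ 2)// /C; ring.
apply: ler_wsqrtr; under eq_bigr do rewrite exprMn.
rewrite -mulr_sumr (_ : (2 * b * cx v) ^+ 2 = b ^+ 2 * (4 * cx v ^+ 2)); last by ring.
by rewrite ler_wpM2l ?sqr_ge0//; exact: sum_sqr_lindiff_le.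
Qed.

Let sum_sqr_rsubmx v : Num.sqrt (\sum_j rsubmx v 0 j ^+ 2) = cy v.
Proof. by rewrite -sqr_enorm sqrtr_sqr ger0_norm ?enorm_ge0. Qed.

Let slope_prod_le j vs :
  `|slope_prod j vs| <= C ^+ size vs * \prod_(v <- vs) cx v.
Proof.
elim: vs => [|v vs IH]; first by rewrite /slope_prod !big_nil normr1 mul1r.
rewrite /slope_prod !big_cons normrM /= exprS mulrACA.
by apply: ler_pM => //; exact: slope_le.
Qed.

(** Cauchy-Schwarz pairs [a] with a single slope and the others are bounded uniformly in [j], so the
    constant is independent of [T]. *)
Let sum_slope_prod_le (a : 'I_T.+1 -> R) vs : (0 < size vs)%N ->
  \sum_j `|a j| * `|slope_prod j vs| <=
  Num.sqrt 2 * C ^+ size vs * Num.sqrt (\sum_j a j ^+ 2) * \prod_(v <- vs) cx v.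
Proof.
case: vs => // v vs _; set P := C ^+ size vs * \prod_(w <- vs) cx w.
have P0 : 0 <= P by rewrite mulr_ge0 ?exprn_ge0.
apply: (@le_trans _ _ (\sum_j `|a j| * `|slope j v| * P)).
  apply: ler_sum => j _; rewrite /slope_prod big_cons normrM mulrA.
  by rewrite ler_wpM2l ?mulr_ge0//; exact: slope_prod_le.
rewrite -mulr_suml; apply: le_trans (ler_wpM2r P0 (sum_norm_le _ _)) _.
apply: le_trans (ler_wpM2r P0 (ler_wpM2l (sqrtr_ge0 _) (sum_sqr_slope_le v))) _.
rewrite /P big_cons exprS le_eqVlt; apply/orP; left; apply/eqP; ring.
Qed.

(** In each term Cauchy-Schwarz pairs [a] with the [y]-component. Only [size vs - 1] slopes occur,
    so the factor [C] on the left makes the power uniform. *)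
Let sum_mixed_prod_le (a : 'I_T.+1 -> R) vs :
  C * \sum_j `|a j| * `|mixed_prod j vs| <=
  C ^+ size vs * Num.sqrt (\sum_j a j ^+ 2) * mixed_norm vs.
Proof.
elim: vs => [|v vs IH] /=.
  by rewrite big1 ?mulr0// => j _; rewrite normr0 mulr0.
set A := Num.sqrt _ in IH *; set P := C ^+ size vs * \prod_(w <- vs) cx w.
have P0 : 0 <= P by rewrite mulr_ge0 ?exprn_ge0.
have h1 : \sum_j `|a j| * `|rsubmx v 0 j| * P <= A * cy v * P.
  by rewrite -mulr_suml ler_wpM2r// -sum_sqr_rsubmx; exact: sum_norm_le.
have h2 : \sum_j `|a j| * `|mixed_prod j vs| * (C * cx v) <=
    C ^+ size vs * A * mixed_norm vs * cx v.
  by rewrite -mulr_suml mulrA ler_wpM2r ?enorm_ge0// mulrC.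
have h3 : \sum_j `|a j| * `|rsubmx v 0 j * slope_prod j vs + slope j v * mixed_prod j vs|
    <= \sum_j `|a j| * `|rsubmx v 0 j| * P +
       \sum_j `|a j| * `|mixed_prod j vs| * (C * cx v).
  rewrite -big_split; apply: ler_sum => j _ /=.
  rewrite -(mulrA `|a j| _ P) -(mulrA `|a j| _ (C * cx v)) -mulrDr.
  rewrite ler_wpM2l//; apply: le_trans (ler_normD _ _) _.
  rewrite (normrM (rsubmx v 0 j)) (normrM (slope j v)).
  apply: lerD; first by rewrite ler_wpM2l//; exact: slope_prod_le.
  by rewrite [leLHS]mulrC ler_wpM2l//; exact: slope_le.
apply: le_trans (ler_wpM2l C_ge0 (le_trans h3 (lerD h1 h2))) _.
rewrite /P exprS le_eqVlt; apply/orP; left; apply/eqP; ring.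
Qed.

(** With [P] the product and [M] the mixed sum, one more direction gives at most
    [(cx v + cy v) * (P + M)], and the first factor is at most [Num.sqrt 2]. *)
Let norms_le vs : (forall v, v \in vs -> enorm v <= 1) ->
  \prod_(v <- vs) cx v + mixed_norm vs <= Num.sqrt 2 ^+ size vs.
Proof.
elim: vs => [_|v vs IH vs1] /=; first by rewrite big_nil addr0 expr0.
have {}IH := IH (fun w wvs => vs1 w (mem_behead (s := v :: vs) wvs)).
have cv : cx v + cy v <= Num.sqrt 2.
  apply: le_trans (sum_le_sqrt2 _ _) _; rewrite -enorm_split.
  by rewrite ler_piMr ?sqrtr_ge0// vs1// mem_head.
have [x0 y0] : 0 <= cx v /\ 0 <= cy v by split; exact: enorm_ge0.
have := mixed_norm_ge0 vs; have := prod_cx_ge0 vs.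
rewrite big_cons exprS; set P := \prod_(w <- vs) _; set M := mixed_norm vs in IH *.
move=> P0 M0; apply: (@le_trans _ _ ((cx v + cy v) * (P + M))); first by nra.
by apply: ler_pM => //; rewrite addr_ge0.
Qed.

(** With [p] directions the gap has exponents 0 and 1 in [chain_derive], so the derivative is affine
    in [z] and the difference is a form in [z - z']. *)
Lemma chain_lipschitz vs z z' : size vs = p -> 0 <= K ->
  (forall v, v \in vs -> enorm v <= 1) ->
  iter_derive (uncurry_mx (chain p K b)) vs z -
  iter_derive (uncurry_mx (chain p K b)) vs z' <=
  K * p`!%:R * (2 * b) ^+ p * 2 * enorm (z - z').
Proof.
move=> vsp K0 vs1; rewrite iter_derive_chain ?vsp// /chain_derive vsp subnn.
have fp : (p ^_ p.-1 = p`!)%N 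
  by case: (p) p_gt0 => // q _; rewrite -ffactnn ffactnSr subSnn muln1.
rewrite ffactnn fp.
set h := z - z'; pose dy j := rsubmx h 0 j; pose dx j := slope j h.
have -> : forall A B A' B' : R, K * A + K * B - (K * A' + K * B') =
    K * ((A - A') + (B - B')) by move=> *; ring.
rewrite -!sumrB -big_split /=.
apply: (@le_trans _ _ (K * (p`!%:R * (\sum_j `|dy j| * `|slope_prod j vs| +
    \sum_j `|dx j| * `|mixed_prod j vs|)))).
  rewrite ler_wpM2l// -big_split mulr_sumr; apply: ler_sum => j _ /=.
  rewrite !expr0 !expr1 !mulr1.
  have -> : p`!%:R * (rsubmx z 0 j * slope_prod j vs) -
      p`!%:R * (rsubmx z' 0 j * slope_prod j vs) +
      (p`!%:R * (mixed_prod j vs * gap b (lsubmx z) j) -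
       p`!%:R * (mixed_prod j vs * gap b (lsubmx z') j)) =
      p`!%:R * (dy j * slope_prod j vs + dx j * mixed_prod j vs).
    rewrite /dy /dx /slope /h !linearB lindiffB /gap !mxE /=.
    ring.
  by rewrite ler_wpM2l// -!normrM lerD// ler_norm.
rewrite -!mulrA ler_wpM2l// ler_wpM2l//.
have vs0 : (0 < size vs)%N by rewrite vsp.
have h1 := sum_slope_prod_le dy vs0; rewrite sum_sqr_rsubmx vsp in h1.
have h2 : \sum_j `|dx j| * `|mixed_prod j vs| <=
    Num.sqrt 2 * C ^+ p * cx h * mixed_norm vs.
  have C0 : 0 < C by rewrite mulr_gt0 ?sqrtr_gt0.
  rewrite -(ler_pM2l C0); apply: le_trans (sum_mixed_prod_le _ _) _.
  rewrite vsp mulrAC; apply: le_trans (ler_wpM2l _ (sum_sqr_slope_le h)) _.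
    by rewrite mulr_ge0 ?exprn_ge0.
  rewrite le_eqVlt; apply/orP; left; apply/eqP; ring.
have := norms_le vs1; rewrite vsp; set P := \prod_(v <- vs) _ in h1 *.
move=> PM; have P0 : 0 <= P := prod_cx_ge0 vs; have M0 := mixed_norm_ge0 vs.
have s0 : 0 <= Num.sqrt 2 * C ^+ p by rewrite mulr_ge0 ?exprn_ge0 ?sqrtr_ge0.
have hx : cx h * mixed_norm vs <= cx h * Num.sqrt 2 ^+ p.
  by rewrite ler_wpM2l ?enorm_ge0//; lra.
have hy : cy h * P <= cy h * Num.sqrt 2 ^+ p.
  by rewrite ler_wpM2l ?enorm_ge0//; lra.
apply: le_trans (lerD h1 h2) _; rewrite -[_ * _ * P]mulrA -[_ * _ * mixed_norm vs]mulrA.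
rewrite -mulrDr; apply: le_trans (ler_wpM2l s0 (lerD hy hx)) _.
rewrite -mulrDl [cy h + _]addrC.
have := sum_le_sqrt2 (cx h) (cy h); rewrite -enorm_split => hh.
apply: le_trans (ler_wpM2l s0 (ler_wpM2r _ hh)) _; first by rewrite exprn_ge0 ?sqrtr_ge0.
(* Since [C * Num.sqrt 2 = 2 * b], the constants combine to [(2 * b) ^+ p * 2]. *)
rewrite le_eqVlt; apply/orP; left; apply/eqP.
rewrite /C -{5 6}[2](@sqr_sqrtr R 2)// !exprMn; ring.
Qed.

Lemma iter_derive_chain_differentiable vs z : (size vs < p)%N ->
  differentiable (iter_derive (uncurry_mx (chain p K b)) vs) z.
Proof.
move=> vsp; rewrite iter_derive_chain ?(ltnW vsp)//.
have lcoord i : differentiable (fun w : 'rV[R]_(T.+1 + T.+1) => lsubmx w 0 i : R) z.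
  rewrite (_ : (fun w => _) = (fun w : 'rV[R]_(T.+1 + T.+1) => w 0 (lshift _ i))).
    exact: differentiable_coord.
  by apply/funext => w; rewrite mxE.
have rcoord i : differentiable (fun w : 'rV[R]_(T.+1 + T.+1) => rsubmx w 0 i : R) z.
  rewrite (_ : (fun w => _) = (fun w : 'rV[R]_(T.+1 + T.+1) => w 0 (rshift _ i))).
    exact: differentiable_coord.
  by apply/funext => w; rewrite mxE.
have gapd j : differentiable (fun w : 'rV[R]_(T.+1 + T.+1) => gap b (lsubmx w) j : R) z.
  rewrite /gap /lindiff; apply: differentiableD => //; apply: differentiableM => //.
  by apply: differentiableB => //; case: (nat_of_ord j == 0%N).
have Xd (f : 'rV[R]_(T.+1 + T.+1) -> R) n : differentiable f z ->
    differentiable (fun w => f w ^+ n) z.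
  move=> fd; elim: n => [|n IH]; first by under eq_fun do rewrite expr0.
  by under eq_fun do rewrite exprS; exact: differentiableM.
have Sd (F : 'I_T.+1 -> 'rV[R]_(T.+1 + T.+1) -> R) :
    (forall j, differentiable (F j) z) ->
    differentiable (fun w => K * \sum_j F j w) z.
  move=> Fd; apply: differentiableM => //.
  rewrite (_ : (fun w => _) = \sum_j F j); first exact: differentiable_sum.
  by apply/funext => w; rewrite fct_sumE.
apply: differentiableD; apply: Sd => j; apply: differentiableM => //;
  apply: differentiableM; rewrite //; try exact: Xd.
exact: differentiableM.
Qed.

End LipschitzDerivatives.

(** * Geometry of the domain and convexity *)

Section ProblemData.
Variables (R : realType) (T : nat) (D : R).
Hypothesis D_gt0 : 0 < D.
Local Open Scope convex_scope.

Let b := beta D T.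
Let b_gt0 : 0 < b := beta_gt0 T D_gt0.

(** The bound of [hard_Z_dist_le] is attained between 0 and the vertex with all coordinates
    [b^-1]. *)
Lemma diameter_hard_Z : diameter (hard_Z D T) = D.
Proof.
pose c : 'rV[R]_T.+1 := const_mx b^-1.
have Zc : hard_Z D T (row_mx c c).
  split; rewrite ?row_mxKl ?row_mxKr.
    by apply/hard_XP => //; split=> [i j _|i]; rewrite !mxE// invr_ge0 lexx andbT ltW.
  by apply/hard_YP => // i; rewrite !mxE// invr_ge0 lexx andbT ltW.
have Z0 : hard_Z D T (row_mx 0 0).
  split; rewrite ?row_mxKl ?row_mxKr.
    by apply/hard_XP => //; split=> [i j _|i]; rewrite !mxE// lexx invr_ge0 ltW.
  by apply/hard_YP => // i; rewrite !mxE// lexx invr_ge0 ltW.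
have distE : enorm (row_mx c c - row_mx 0 0) = D.
  rewrite row_mx0 subr0 enorm_split row_mxKl row_mxKr sqr_enorm.
  have -> : \sum_i c 0 i ^+ 2 = T.+1%:R * b ^- 2.
    rewrite -exprVn (eq_bigr (fun=> b^-1 ^+ 2)) => [|i _]; last by rewrite mxE.
    by rewrite sumr_const card_ord mulr_natl.
  rewrite /b /beta /diam_bar expr_div_n sqr_sqrtr//.
  rewrite (_ : _ + _ = D ^+ 2); last first.
    have : T.+1%:R != 0 :> R by rewrite pnatr_eq0.
    by move: (T.+1%:R) => n n0; field; rewrite n0 gt_eqF.
  by rewrite sqrtr_sqr gtr0_norm.
have ubD : ubound [set r | exists z z',
    [/\ hard_Z D T z, hard_Z D T z' & r = enorm (z - z')]] D.
  by move=> _ [z [z' [Zz Zz' ->]]]; exact: hard_Z_dist_le.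
have inD : [set r | exists z z',
    [/\ hard_Z D T z, hard_Z D T z' & r = enorm (z - z')]] D.
  by exists (row_mx c c), (row_mx 0 0).
apply/eqP; rewrite eq_le; apply/andP; split.
  by apply: ge_sup => //; exists D.
by apply: ub_le_sup => //; exists D.
Qed.

Lemma hard_X_convex : convex_set (hard_X D T).
Proof.
move=> x y t; rewrite !in_setE => /(hard_XP D_gt0)[xle x01] /(hard_XP D_gt0)[yle y01].
have t0 : 0 <= t%:num by []; have t1 : 0 <= 1 - t%:num by rewrite subr_ge0.
apply/(hard_XP D_gt0); split=> [i j ij|i].
  by rewrite !mxE lerD// ler_wpM2l ?xle ?yle.
have /andP[x0 x1] := x01 i; have /andP[y0 y1] := y01 i; rewrite !mxE.
by apply/andP; split; rewrite /unstable.onem; nra.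
Qed.

Lemma hard_Y_convex : convex_set (hard_Y D T).
Proof.
move=> x y t; rewrite !in_setE => /(hard_YP D_gt0) x01 /(hard_YP D_gt0) y01.
have t0 : 0 <= t%:num by []; have t1 : 0 <= 1 - t%:num by rewrite subr_ge0.
apply/(hard_YP D_gt0) => i.
have /andP[x0 x1] := x01 i; have /andP[y0 y1] := y01 i; rewrite !mxE.
by apply/andP; split; rewrite /unstable.onem; nra.
Qed.

Lemma hard_Y_compact : compact (hard_Y D T).
Proof.
rewrite (_ : hard_Y D T = [set v : 'rV[R]_T.+1 | forall i, `[0, b^-1]%classic (v ord0 i)]).
  by apply: (@rV_compact _ _ (fun=> `[0, b^-1]%classic)) => i; exact: segment_compact.
apply/seteqP; split=> [y /(hard_YP D_gt0) yP i|y yP]; rewrite /= ?in_itv /=.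
  exact: yP.
by apply/(hard_YP D_gt0) => i; have := yP i; rewrite /= in_itv.
Qed.

Lemma hard_X_compact : compact (hard_X D T).
Proof.
rewrite (_ : hard_X D T = hard_Y D T `&`
    \bigcap_(ij in [set ij : 'I_T.+1 * 'I_T.+1 | (ij.1 <= ij.2)%N])
    [set x | x 0 ij.2 - x 0 ij.1 <= 0]).
  apply: compact_closedI; first exact: hard_Y_compact.
  apply: closed_bigI => -[i j] _.
  apply: (@preimage_closed _ _ (fun x : 'rV[R]_T.+1 => x 0 j - x 0 i) [set r | r <= 0]).
    by move=> x _; apply/differentiable_continuous; apply: differentiableB; exact: differentiable_coord.
  exact: closed_le.
apply/seteqP; split=> x.
  move=> /(hard_XP D_gt0)[xle x01]; split; first exact/(hard_YP D_gt0).
  by move=> [i j] /= ij; rewrite subr_le0 xle.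
move=> [/(hard_YP D_gt0) x01 xle]; apply/(hard_XP D_gt0); split=> // i j ij.
by have := xle (i, j) ij; rewrite /= subr_le0.
Qed.

Variables (p : nat) (L : R).
Hypotheses (p_gt0 : (0 < p)%N) (L_gt0 : 0 < L).

(** In the weighted sum of the tangent inequalities at [m], the linear terms cancel. *)
Lemma exprn_convex (t u v : R) : 0 <= t -> t <= 1 -> 0 <= u -> 0 <= v ->
  (t * u + (1 - t) * v) ^+ p <= t * u ^+ p + (1 - t) * v ^+ p.
Proof.
move=> t0 t1 u0 v0; set m := t * u + (1 - t) * v.
have t1' : 0 <= 1 - t by rewrite subr_ge0.
have m0 : 0 <= m by rewrite addr_ge0// mulr_ge0.
have hu := ler_wpM2l t0 (exprn_tangent_le p_gt0 m0 u0).
have hv := ler_wpM2l t1' (exprn_tangent_le p_gt0 m0 v0).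
apply: le_trans (lerD hu hv); rewrite le_eqVlt; apply/orP; left; apply/eqP.
by rewrite /m; ring.
Qed.

(** The gaps are affine in [x] and nonnegative on [hard_X], and the weights [y_j] are
    nonnegative. *)
Lemma hard_f_convex y : hard_Y D T y ->
  convex_function (hard_X D T) (fun x => hard_f p L D T x y).
Proof.
move=> /(hard_YP D_gt0) y01 t x x'; rewrite !in_setE => Xx Xx'.
rewrite convRE hard_fE// /chain; set K := chain_coef _ _ _ _.
have K0 : 0 <= K by rewrite ltW// chain_coef_gt0.
rewrite mulrCA [X in _ + X]mulrCA -mulrDr ler_wpM2l// !mulr_sumr -big_split.
apply: ler_sum => j _ /=; rewrite mulrCA [X in _ + X]mulrCA -mulrDr.
have /andP[yj _] := y01 j; rewrite ler_wpM2l//.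
apply: le_trans (exprn_convex _ _ (gap_ge0 D_gt0 j Xx) (gap_ge0 D_gt0 j Xx')) => //.
rewrite le_eqVlt; apply/orP; left; apply/eqP; congr (_ ^+ _).
rewrite -[_ <| _ |> _]/(t%:num *: x + (1 - t%:num) *: x') /gap.
by rewrite lindiffD !lindiffZ; ring.
Qed.

Lemma hard_f_concave x : hard_X D T x ->
  convex_function (hard_Y D T) (fun y => - hard_f p L D T x y).
Proof.
move=> _ t y y' _ _; rewrite convRE hard_fE// /chain /unstable.onem.
rewrite -[_ <| _ |> _]/(t%:num *: y + (1 - t%:num) *: y').
rewrite le_eqVlt; apply/orP; left; apply/eqP.
rewrite !mulrN -opprD; congr (- _).
set K := chain_coef _ _ _ _.
transitivity (K * (t%:num * (\sum_j y 0 j * gap b x j ^+ p) +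
    (1 - t%:num) * \sum_j y' 0 j * gap b x j ^+ p)); last by rewrite -/b; ring.
congr (_ * _); rewrite !mulr_sumr -big_split; apply: eq_bigr => j _ /=.
by rewrite !mxE -/b; ring.
Qed.

Lemma hard_f_lipschitz :
  lipschitz_derivatives p L (hard_Z D T) (uncurry_mx (hard_f p L D T)).
Proof.
rewrite hard_fE// -/b; split=> [vs z vsp _|z z' _ _].
  exists (fun=> fun=> setT) => [i j|w _ /=]; first exact: filterT.
  exact: iter_derive_chain_differentiable.
apply: ub_ereal_sup => _ [vs /= vs1 <-]; rewrite lee_fin.
set K := chain_coef _ _ _ _.
have K0 : 0 <= K by rewrite ltW// chain_coef_gt0.
apply: le_trans (chain_lipschitz p_gt0 b_gt0 z z' (size_tuple vs) K0 _) _.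
  by move=> v /tnthP[i ->]; exact: vs1.
rewrite le_eqVlt; apply/orP; left; apply/eqP; congr (_ * _).
(* The normalization in [chain_coef] makes the Lipschitz constant exactly [L]. *)
rewrite /K /chain_coef -/b (exprMn p 2 b) exprS; field.
by rewrite !expf_neq0 ?pnatr_eq0 -?lt0n ?fact_gt0 ?gt_eqF.
Qed.

End ProblemData.

(** For [D = diam_bar R T] the scaling [beta] is 1, so [hard_Z] is [Zbar]. *)
Lemma diameter_Zbar (R : realType) (T : nat) : diameter (@Zbar R T) = diam_bar R T.
Proof.
have d0 : 0 < diam_bar R T by rewrite sqrtr_gt0 mulr_gt0.
rewrite -[RHS](diameter_hard_Z T d0) /hard_Z /hard_X /hard_Y /beta divff ?gt_eqF//.
by congr diameter; apply/seteqP; split=> z; rewrite /Zbar /prod_set /dilate_inv /= !scale1r.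
Qed.

(** * Oracle complexity *)

Section OracleComplexity.
Variables (R : realType) (p : nat).
Hypothesis p_gt0 : (0 < p)%N.

Let e : R := (3 * p%:R - 1) / 2.
Let c0 : R := residual_coef R p.

Let e_gt0 : 0 < e.
Proof.
have p1 : 1 <= p%:R :> R by rewrite ler1n.
by rewrite /e; lra.
Qed.

Let powRK (x : R) : 0 <= x -> (x `^ e) `^ e^-1 = x.
Proof. by move=> x0; rewrite -powRrM mulfV ?powRr1// gt_eqF. Qed.

(* [T] is chosen so that [T + 1] is just below
   [(c0 * D ^+ p * L / eps) `^ e^-1], beyond which the residual bound of
   [run_residual_ge] drops under [eps]; for [eps] at most
   [c0 / 3 `^ e * D ^+ p * L] this threshold is at least [3]. *)
Lemma oracle_complexity (L D eps : R) : 0 < L -> 0 < D -> 0 < eps ->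
  eps <= c0 / 3 `^ e * (D ^+ p * L) ->
  exists2 T : nat, (1 <= T)%N &
    forall (N : nat) (x y : nat -> 'rV[R]_T.+1),
      tensor_algorithm_run p (hard_X D T) (hard_Y D T) (hard_f p L D T) N x y ->
      tangent_residual (hard_F p L D T) (hard_Z D T) (row_mx (x N) (y N)) <= eps ->
      c0 `^ e^-1 / 3 * (D ^+ p * L / eps) `^ e^-1 <= N%:R.
Proof.
move=> L0 D0 eps0 epsk; have c00 : 0 < c0 := residual_coef_gt0 R p.
set B := D ^+ p * L / eps.
have B0 : 0 < B by rewrite divr_gt0// mulr_gt0 ?exprn_gt0.
pose S := (c0 * B) `^ e^-1.
have ei0 : 0 <= e^-1 by rewrite invr_ge0 ltW.
have S0 : 0 <= S by exact: powR_ge0.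
have S3 : 3 <= S.
  have p3 : 0 < 3 `^ e :> R by exact: powR_gt0.
  rewrite -[3]powRK//; apply: ge0_ler_powR => //.
  - by rewrite nnegrE ltW.
  - by rewrite nnegrE mulr_ge0// ltW.
  - rewrite /B mulrA ler_pdivlMr// mulrC -ler_pdivlMr//.
    by apply: le_trans epsk _; rewrite le_eqVlt; apply/orP; left; apply/eqP; ring.
have n3 : (3 <= Num.truncn S)%N by rewrite truncn_ge_nat.
(* The integer part of [S] is written [T.+3]. The instance has parameter [T.+1], so its [T.+2] is
   strictly below [S]. *)
move: (Num.truncn S) (truncn_itv S0) n3 => [|[|[|T]]] // /andP[nS Sn] _.
exists T.+1 => // N x y run res.
have -> : c0 `^ e^-1 / 3 * B `^ e^-1 = S / 3.
  by rewrite /S powRM ?(ltW c00) ?(ltW B0)//; ring.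
(* A longer run has [N >= T + 2 >= S / 3], as [S < T + 4]. A shorter one would force [S <= T + 2] by
   the residual bound. *)
have [NT|TN] := leqP N T.+1; last first.
  have : T.+2%:R <= N%:R :> R by rewrite ler_nat.
  move: Sn; rewrite -[T.+4%:R]natr1 -[T.+3%:R]natr1; lra.
have := le_trans (run_residual_ge p_gt0 L0 D0 NT run) res.
rewrite -/c0 -/e => hres.
have m0 : 0 < T.+2%:R :> R by [].
have me0 : 0 < T.+2%:R `^ e :> R by exact: powR_gt0.
suff : S <= T.+2%:R by move: nS; rewrite -[T.+3%:R]natr1; lra.
rewrite -[T.+2%:R]powRK ?(ltW m0)//; apply: ge0_ler_powR => //.
- by rewrite nnegrE mulr_ge0// ltW.
- by rewrite nnegrE ltW.
- rewrite /B mulrA ler_pdivrMr// -ler_pdivrMl//.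
  by apply: le_trans hres; rewrite le_eqVlt; apply/orP; left; apply/eqP; ring.
Qed.

End OracleComplexity.

Unset Implicit Arguments.

Theorem theorem5p2 (R : realType) (p : nat) (hp : (1 <= p)%N) :
  (* the problem data and item 1 *)
  (forall (L D : R) (T : nat), 0 < L -> 0 < D -> (1 <= T)%N ->
    [/\ diameter (@Zbar R T) = diam_bar R T,
        diameter (hard_Z D T) = D,
        [/\ convex_set (hard_X D T), compact (hard_X D T),
            convex_set (hard_Y D T) & compact (hard_Y D T)],
        (forall y, hard_Y D T y ->
           convex_function (hard_X D T) (fun x => hard_f p L D T x y)) /\
        (forall x, hard_X D T x ->
           convex_function (hard_Y D T) (fun y => - hard_f p L D T x y)) &
        lipschitz_derivatives p L (hard_Z D T)
          (uncurry_mx (hard_f p L D T))]) /\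
  (* item 2 *)
  (exists2 c : R, 0 < c &
    forall (L D : R) (T : nat), 0 < L -> 0 < D -> (1 <= T)%N ->
    forall x y : nat -> 'rV[R]_T.+1,
      tensor_algorithm_run p (hard_X D T) (hard_Y D T) (hard_f p L D T) T
        x y ->
      tangent_residual (hard_F p L D T) (hard_Z D T)
        (row_mx (x T) (y T))
      >= c * (L * D ^+ p / T.+1%:R `^ ((3 * p%:R - 1) / 2))) /\
  (* oracle complexity *)
  (exists c k : R, [/\ 0 < c, 0 < k &
    forall L D eps : R, 0 < L -> 0 < D -> 0 < eps -> eps <= k * (D ^+ p * L) ->
    exists2 T : nat, (1 <= T)%N &
      forall (N : nat) (x y : nat -> 'rV[R]_T.+1),
        tensor_algorithm_run p (hard_X D T) (hard_Y D T) (hard_f p L D T) N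
          x y ->
        tangent_residual (hard_F p L D T) (hard_Z D T)
          (row_mx (x N) (y N)) <= eps ->
        N%:R >= c * (D ^+ p * L / eps) `^ (2 / (3 * p%:R - 1))]).
Proof.
split=> [L D T L0 D0 _|].
  split.
  - exact: diameter_Zbar.
  - exact: diameter_hard_Z.
  - by split; [exact: hard_X_convex|exact: hard_X_compact|exact: hard_Y_convex|
      exact: hard_Y_compact].
  - by split=> [y|x]; [exact: hard_f_convex|exact: hard_f_concave].
  - exact: hard_f_lipschitz.
split.
  exists (residual_coef R p) => [|L D T L0 D0 _ x y]; first exact: residual_coef_gt0.
  exact: run_residual_ge.
have c0 := residual_coef_gt0 R p.
exists (residual_coef R p `^ ((3 * p%:R - 1) / 2)^-1 / 3),
  (residual_coef R p / 3 `^ ((3 * p%:R - 1) / 2)).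
split; [by rewrite divr_gt0 ?powR_gt0|by rewrite divr_gt0 ?powR_gt0|].
move=> L D eps L0 D0 eps0 epsk.
have [T T1 TP] := oracle_complexity hp L0 D0 eps0 epsk.
exists T => // N x y run res; rewrite -[2 / _]invf_div.
by move: (TP _ _ _ run res).
Qed.
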